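(* Let $k\ge 1$ be an integer and $\theta = 2\pi/(4k+5)$. Let $P$ be a finite set of points in general position and $S$ a set of constraints on $P$. Let $u,w\in P$ be two vertices such that $u$ can see $w$, let $m$ be the midpoint of the side of the canonical triangle $T_{uw}$ opposite $u$, and let $\alpha$ be the unsigned angle between $uw$ and $um$. Then there exists a path connecting $u$ and $w$ in the constrained $\theta_{(4k+5)}$-graph of $P$ with respect to $S$ of length at most \[\left( \frac{\cos \alpha}{\cos \left(\frac{\theta}{2}\right)} + \frac{\left( \cos \alpha \cdot \tan \left(\frac{\theta}{2}\right) + \sin \alpha \right) \cdot \cos \left(\frac{\theta}{4}\right)}{\cos \left(\frac{\theta}{2}\right) - \sin \left(\frac{3\theta}{4}\right)} \right) \cdot |u w|.\]
   Context: $P$ is a finite set of points in the plane and $S$ is a set of line segments (called constraints), each joining two points of $P$, such that no two constraints intersect properly. Two points $u,v\in P$ can see each other if and only if the segment $uv$ does not properly intersect any constraint or $uv$ is itself a constraint. Fix an integer $k\ge 1$, $x\in\{2,3,4,5\}$ and $\theta=2\pi/(4k+x)$. Around each point $u$, the $4k+x$ rays from $u$ with angle $\theta$ between consecutive rays define cones; they are oriented so that the bisector of one cone, $C_0^u$, is the vertical half-line above $u$, and the cones are numbered $C_0^u, C_1^u, \dots$ clockwise; all points use the same orientation. For every constraint $uv$ with $v\in C_i^u$, the line through that constraint splits $C_i^u$; the resulting pieces are the subcones of $C_i^u$ (if a constraint $uv$ splits a cone of $u$ into two subcones, $v$ is considered to lie in both; a cone not split is a single subcone). The constrained $\theta_{(4k+x)}$-graph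 has vertex set $P$ and, for each vertex $u$ and each subcone of each cone $C_i^u$, an edge between $u$ and the vertex $v$ of that subcone that can see $u$ and whose orthogonal projection onto the bisector of the full cone $C_i^u$ (not of the subcone) is closest to $u$ among all vertices of that subcone that can see $u$. Edges are weighted by Euclidean length, and the length of a path is the sum of its edge lengths. General position: no two points lie on a line parallel to one of the rays defining the cones, no two points lie on a line perpendicular to the bisector of a cone, and no three points are collinear. For a vertex $w$ in cone $C_i^u$, the canonical triangle $T_{uw}$ is the triangle bounded by the two boundary rays of $C_i^u$ and the line through $w$ perpendicular to the bisector of $C_i^u$. *)

(* Defs.v *)
From Stdlib Require Import Reals Lra List.
Open Scope R_scope.

Definition point : Type := (R * R)%type.

Definition vsub (a b : point) : point := (fst a - fst b, snd a - snd b).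
Definition dot (a b : point) : R := fst a * fst b + snd a * snd b.
Definition cross (a b : point) : R := fst a * snd b - snd a * fst b.
Definition norm (a : point) : R := sqrt (dot a a).
Definition pdist (a b : point) : R := norm (vsub b a).

Definition vangle (a b : point) : R := acos (dot a b / (norm a * norm b)).

Definition cone_angle (n : nat) : R := 2 * PI / INR n.

(* unit bisector of cone C_i: C_0 points vertically up, cones numbered
   clockwise, so the bisector of C_i has direction angle pi/2 - i*theta *)
Definition bisector (n i : nat) : point :=
  (sin (INR i * cone_angle n), cos (INR i * cone_angle n)).

(* unit direction of the j-th ray bounding the cones (between C_j and C_(j+1)) *)
Definition ray_dir (n j : nat) : point :=
  (sin ((INR j + / 2) * cone_angle n), cos ((INR j + / 2) * cone_angle n)).

(* v lies in (the interior of) cone C_i^u: the angle between v - u and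
   the bisector is less than theta/2 *)
Definition in_cone (n i : nat) (u v : point) : Prop :=
  (i < n)%nat /\ v <> u /\
  dot (vsub v u) (bisector n i) > norm (vsub v u) * cos (cone_angle n / 2).

Definition proj (n i : nat) (u w : point) : R := dot (vsub w u) (bisector n i).

Definition is_constraint (S : list (point * point)) (a b : point) : Prop :=
  In (a, b) S \/ In (b, a) S.

(* proper intersection of segments ab and cd (crossing at a point interior
   to both segments) *)
Definition orient (a b c : point) : R := cross (vsub b a) (vsub c a).
Definition proper_intersect (a b c d : point) : Prop :=
  orient a b c * orient a b d < 0 /\ orient c d a * orient c d b < 0.

Definition can_see (S : list (point * point)) (u v : point) : Prop :=
  is_constraint S u v \/
  (forall c, In c S -> ~ proper_intersect u v (fst c) (snd c)).

(* The constraint ray u->z (z in C_i^u, uz a constraint) strictly separates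
   the directions p and q inside the cone (all directions in a cone of angle
   < pi are angularly ordered by the sign of the cross product). *)
Definition separates (S : list (point * point)) (n i : nat) (u : point)
    (p q : point) : Prop :=
  exists z, is_constraint S u z /\ in_cone n i u z /\
    cross (vsub z u) p * cross (vsub z u) q < 0.

(* Subcone of C_i^u determined by a direction d lying strictly inside the cone
   and on no constraint ray: the closed sector between the two consecutive
   constraint rays (or cone boundaries) around d.  A constraint endpoint lying
   on a splitting ray belongs to both adjacent subcones.  Every subcone of
   C_i^u is of this form. *)
Definition subcone_dir (S : list (point * point)) (n i : nat) (u d : point)
  : Prop :=
  in_cone n i u (fst u + fst d, snd u + snd d) /\
  (forall z, is_constraint S u z -> in_cone n i u z -> cross (vsub z u) d <> 0).

Definition in_subcone (S : list (point * point)) (n i : nat) (u d w : point)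
  : Prop :=
  in_cone n i u w /\ ~ separates S n i u (vsub w u) d.

Definition theta_edge_from (n : nat) (P : list point) (S : list (point * point))
    (u v : point) : Prop :=
  In u P /\ In v P /\
  exists i d, subcone_dir S n i u d /\ in_subcone S n i u d v /\ can_see S u v /\
    forall w, In w P -> in_subcone S n i u d w -> can_see S u w ->
      proj n i u v <= proj n i u w.

Definition theta_adj (n : nat) (P : list point) (S : list (point * point))
    (u v : point) : Prop :=
  theta_edge_from n P S u v \/ theta_edge_from n P S v u.

Fixpoint is_path (G : point -> point -> Prop) (p : point) (l : list point)
  : Prop :=
  match l with
  | nil => True
  | q :: l' => G p q /\ is_path G q l'
  end.

Fixpoint path_length (p : point) (l : list point) : R :=
  match l with
  | nil => 0
  | q :: l' => pdist p q + path_length q l'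
  end.

Definition valid_constraints (P : list point) (S : list (point * point))
  : Prop :=
  (forall c, In c S -> In (fst c) P /\ In (snd c) P /\ fst c <> snd c) /\
  (forall c c', In c S -> In c' S ->
     ~ proper_intersect (fst c) (snd c) (fst c') (snd c')).

Definition general_position (n : nat) (P : list point) : Prop :=
  (forall a b, In a P -> In b P -> a <> b ->
     forall j, (j < n)%nat -> cross (vsub b a) (ray_dir n j) <> 0) /\
  (forall a b, In a P -> In b P -> a <> b ->
     forall i, (i < n)%nat -> dot (vsub b a) (bisector n i) <> 0) /\
  (forall a b c, In a P -> In b P -> In c P -> a <> b -> a <> c -> b <> c ->
     orient a b c <> 0).

(* midpoint of the side of the canonical triangle T_uw (w in C_i^u)
   opposite u: the point of the bisector at projection distance of w *)
Definition canon_mid (n i : nat) (u w : point) : point :=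
  (fst u + proj n i u w * fst (bisector n i),
   snd u + proj n i u w * snd (bisector n i)).

(* Main.v *)
(** Let [n = 4k + 5] and let [T] be the tangent of half the cone angle.  In the
    coordinates [h], [x] along and across the bisector of the cone of [u] that
    contains [w], the bound reads [h / cos (theta/2) + c (T h + |x|)]; it is proved by
    induction on the height of the canonical triangle.

    Let [v0] be the neighbour of [u] in the subcone of [w].  The lower hull of the
    points in the triangle [u v0 w] is a chain of mutually visible points from [v0]
    to [w], with strictly increasing [h].  For each chain edge the canonical triangle
    in its own cone is smaller than that of [uw], so the induction hypothesis
    applies, and as the edge makes an angle of at most [pi/2] with the bisector of
    the original cone, the resulting bound does not exceed its bound in the frame of
    the original cone.  There the bounds add up, because convexity limits the
    variation of [x] along the chain to [|x(v0)| + |x(w)|], while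
    [|u v0| <= h(v0) / cos (theta/2) + c (T h(v0) - |x(v0)|)]. *)
Require Import Defs.
From Stdlib Require Import Reals Lra Lia List ZArith Classical.
Open Scope R_scope.

(** * Cones and bisectors *)

Definition half_tan (n : nat) : R := tan (cone_angle n / 2).

Definition chain_factor (n : nat) : R :=
  cos (cone_angle n / 4) / (cos (cone_angle n / 2) - sin (3 * cone_angle n / 4)).

Lemma cone_angle_mul (n : nat) : (0 < n)%nat -> INR n * cone_angle n = 2 * PI.
Proof.
  intros Hn. unfold cone_angle. field. apply not_0_INR. lia.
Qed.

Lemma cone_angle_bounds (n : nat) :
  (9 <= n)%nat -> 0 < cone_angle n /\ cone_angle n < PI / 4.
Proof.
  intros Hn.
  assert (H9 : 9 <= INR n) by (replace 9 with (INR 9) by (simpl; lra); now apply le_INR).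
  pose proof (cone_angle_mul n ltac:(lia)) as E.
  pose proof PI_RGT_0. split; nra.
Qed.

Lemma half_cos_pos (n : nat) : (9 <= n)%nat -> 0 < cos (cone_angle n / 2).
Proof.
  intros Hn. destruct (cone_angle_bounds n Hn). pose proof PI_RGT_0.
  apply cos_gt_0; lra.
Qed.

Lemma half_sin_pos (n : nat) : (9 <= n)%nat -> 0 < sin (cone_angle n / 2).
Proof.
  intros Hn. destruct (cone_angle_bounds n Hn). pose proof PI_RGT_0.
  apply sin_gt_0; lra.
Qed.

Lemma half_tan_mul_cos (n : nat) :
  (9 <= n)%nat -> half_tan n * cos (cone_angle n / 2) = sin (cone_angle n / 2).
Proof.
  intros Hn. pose proof (half_cos_pos n Hn). unfold half_tan, tan. field. lra.
Qed.

(** With [a = theta/2], the bound [theta < pi/4] gives [2 sin a cos a < cos^2 a - sin^2 a], hence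
    [2 sin a < cos a]. The value [1/2] is what [edge_proj_lt] needs. *)
Lemma half_tan_bounds (n : nat) : (9 <= n)%nat -> 0 < half_tan n < / 2.
Proof.
  intros Hn. pose proof (half_cos_pos n Hn) as Hc. pose proof (half_sin_pos n Hn) as Hs.
  pose proof (half_tan_mul_cos n Hn) as E.
  destruct (cone_angle_bounds n Hn) as [H0 H1]. pose proof PI_RGT_0.
  assert (Hlt : sin (cone_angle n) < cos (cone_angle n)).
  { rewrite <- (sin_shift (cone_angle n)). apply sin_increasing_1; lra. }
  replace (cone_angle n) with (2 * (cone_angle n / 2)) in Hlt by lra.
  rewrite sin_2a, cos_2a in Hlt.
  split; [nra|].
  assert (2 * sin (cone_angle n / 2) < cos (cone_angle n / 2)) by nra.
  nra.
Qed.

Lemma cos_le_cos_away (a t : R) :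
  0 <= a <= PI -> a <= t <= 2 * PI - a -> cos t <= cos a.
Proof.
  intros Ha Ht. destruct (Rle_dec t PI).
  - apply cos_decr_1; lra.
  - replace (cos t) with (cos (2 * PI - t)).
    + apply cos_decr_1; lra.
    + rewrite cos_minus, cos_2PI, sin_2PI. ring.
Qed.

(** After multiplication by [cos (theta/2)] the claim for an angle [b] reads
    [cos (b - theta/2) <= cos (theta/2)] or [cos (b + theta/2) <= cos (theta/2)], by the sign of
    [sin b]. Modulo [2 pi], a nonzero [b] lies between [theta] and [2 pi - theta], so both shifted
    angles stay [theta/2] away from the multiples of [2 pi]. *)
Lemma bisector_gap_nat (n r : nat) : (9 <= n)%nat ->
  cos (INR r * cone_angle n) + half_tan n * Rabs (sin (INR r * cone_angle n)) <= 1.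
Proof.
  intros Hn. pose proof (cone_angle_mul n ltac:(lia)) as E.
  assert (Hred : exists r', (r' < n)%nat /\
    cos (INR r * cone_angle n) = cos (INR r' * cone_angle n) /\
    sin (INR r * cone_angle n) = sin (INR r' * cone_angle n)).
  { exists (r mod n)%nat. split; [apply Nat.mod_upper_bound; lia|].
    assert (Hr : INR r * cone_angle n =
                 INR (r mod n) * cone_angle n + 2 * INR (r / n) * PI).
    { rewrite (Nat.div_mod_eq r n) at 1. rewrite plus_INR, mult_INR.
      replace (2 * INR (r / n) * PI) with (INR (r / n) * (2 * PI)) by ring.
      rewrite <- E. ring. }
    rewrite Hr. split; [apply cos_period|apply sin_period]. }
  destruct Hred as (r' & Hr' & -> & ->).
  destruct r' as [|r'].
  { simpl INR. rewrite Rmult_0_l, cos_0, sin_0, Rabs_R0. lra. }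
  destruct (cone_angle_bounds n Hn) as [Ht0 Ht1].
  pose proof (half_cos_pos n Hn) as Hc. pose proof (half_tan_mul_cos n Hn) as ET.
  assert (H1 : cone_angle n <= INR (S r') * cone_angle n).
  { rewrite S_INR. pose proof (pos_INR r'). nra. }
  assert (H2 : INR (S r') * cone_angle n <= 2 * PI - cone_angle n).
  { assert (INR (S r') + 1 <= INR n).
    { rewrite <- S_INR. apply le_INR. lia. }
    nra. }
  set (b := INR (S r') * cone_angle n) in *.
  pose proof PI_RGT_0.
  assert (G1 : cos (b - cone_angle n / 2) <= cos (cone_angle n / 2))
    by (apply cos_le_cos_away; lra).
  assert (G2 : cos (b + cone_angle n / 2) <= cos (cone_angle n / 2))
    by (apply cos_le_cos_away; lra).
  rewrite cos_minus in G1. rewrite cos_plus in G2. rewrite <- ET in G1, G2.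
  apply Rmult_le_reg_r with (1 := Hc).
  unfold Rabs; destruct (Rcase_abs (sin b)); lra.
Qed.

(* The cone bisectors are spaced by [theta], so the sector spanned by one cone
   contains no other bisector; the estimate is the analytic form of this. *)
Lemma bisector_gap (n : nat) (z : Z) : (9 <= n)%nat ->
  cos (IZR z * cone_angle n) + half_tan n * Rabs (sin (IZR z * cone_angle n)) <= 1.
Proof.
  intros Hn. destruct (Z_le_gt_dec 0 z) as [Hz|Hz].
  - rewrite <- (Z2Nat.id z Hz), <- INR_IZR_INZ. now apply bisector_gap_nat.
  - pose proof (bisector_gap_nat n (Z.to_nat (- z)) Hn) as G.
    rewrite INR_IZR_INZ, Z2Nat.id in G by lia.
    rewrite opp_IZR in G.
    replace (- IZR z * cone_angle n) with (- (IZR z * cone_angle n)) in G by ring.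
    now rewrite cos_neg, sin_neg, Rabs_Ropp in G.
Qed.

(** A rotation through [(l - i) theta] carries the bisector of [C_i] to that of [C_l]; the index
    difference is signed, hence taken in [Z]. *)
Lemma dot_bisector_shift (n : nat) (l i : nat) (v : point) :
  dot v (bisector n l) =
  dot v (bisector n i) * cos (IZR (Z.of_nat l - Z.of_nat i) * cone_angle n) +
  cross v (bisector n i) * sin (IZR (Z.of_nat l - Z.of_nat i) * cone_angle n).
Proof.
  rewrite minus_IZR, <- !INR_IZR_INZ.
  unfold dot, cross, bisector; cbn [fst snd].
  replace (INR l * cone_angle n)
    with (INR i * cone_angle n + (INR l - INR i) * cone_angle n) by ring.
  rewrite sin_plus, cos_plus. ring.
Qed.

Lemma dot_self_bisector (n i : nat) (v : point) :
  dot v v = dot v (bisector n i) ^ 2 + cross v (bisector n i) ^ 2.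
Proof.
  unfold dot, cross, bisector; cbn [fst snd].
  pose proof (sin2_cos2 (INR i * cone_angle n)) as E. unfold Rsqr in E.
  set (s := sin _) in *; set (c := cos _) in *.
  replace (fst v * fst v + snd v * snd v)
    with ((fst v * fst v + snd v * snd v) * (s * s + c * c)) by (rewrite E; ring).
  ring.
Qed.

Lemma dot_self_nonneg (v : point) : 0 <= dot v v.
Proof. unfold dot. nra. Qed.

Lemma norm_nonneg (v : point) : 0 <= norm v.
Proof. apply sqrt_pos. Qed.

Lemma norm_sqr (v : point) : norm v * norm v = dot v v.
Proof. apply sqrt_sqrt, dot_self_nonneg. Qed.

Lemma vsub_dot_pos (u v : point) : v <> u -> 0 < dot (vsub v u) (vsub v u).
Proof.
  intros H. destruct u as [a b], v as [c d]. unfold dot, vsub; cbn [fst snd].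
  destruct (Req_dec c a) as [->|Hc].
  - assert (Hd : d - b <> 0) by (intros E; apply H; replace d with b by lra; reflexivity).
    pose proof (Rsqr_pos_lt _ Hd) as Hq. unfold Rsqr in Hq. nra.
  - assert (Hd : c - a <> 0) by lra.
    pose proof (Rsqr_pos_lt _ Hd) as Hq. pose proof (Rle_0_sqr (d - b)) as Hr.
    unfold Rsqr in Hq, Hr. lra.
Qed.

Lemma norm_vsub_pos (u v : point) : v <> u -> 0 < norm (vsub v u).
Proof. intros H. apply sqrt_lt_R0. now apply vsub_dot_pos. Qed.

(** Squaring turns the cosine condition into [x^2 < T^2 h^2], because
    [1 / cos^2 (theta/2) = 1 + T^2]. In this form membership in a cone is a pair of strict linear
    inequalities, which suits arguments with affine functions. *)
Lemma in_cone_iff (n i : nat) (u v : point) : (9 <= n)%nat ->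
  in_cone n i u v <->
  (i < n)%nat /\
  Rabs (cross (vsub v u) (bisector n i)) < half_tan n * dot (vsub v u) (bisector n i).
Proof.
  intros Hn. pose proof (half_cos_pos n Hn) as Hc. pose proof (half_tan_bounds n Hn) as HT.
  pose proof (half_tan_mul_cos n Hn) as ET.
  pose proof (sin2_cos2 (cone_angle n / 2)) as E1. unfold Rsqr in E1. rewrite <- ET in E1.
  pose proof (norm_sqr (vsub v u)) as EN. rewrite (dot_self_bisector n i) in EN.
  pose proof (norm_nonneg (vsub v u)) as HN.
  unfold in_cone.
  set (x := cross _ _) in *; set (h := dot _ (bisector n i)) in *.
  set (N := norm _) in *; set (C := cos _) in *; set (T := half_tan n) in *.
  assert (EC : (T * T + 1) * (C * C) = 1) by lra.
  pose proof (Rabs_pos x) as Hx. pose proof (pow2_abs x) as Ex. set (ax := Rabs x) in *.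
  rewrite <- Ex in EN.
  split.
  - intros (Hi & _ & H). split; [exact Hi|].
    assert (HNC : 0 <= N * C) by (apply Rmult_le_pos; lra).
    assert (Hh : 0 < h) by lra.
    assert (HH : N * C * (N * C) < h * h) by (apply Rmult_le_0_lt_compat; lra).
    assert (H2 : (h * h + ax * ax) < h * h * (T * T + 1)).
    { apply Rmult_lt_reg_r with (C * C); [now apply Rmult_lt_0_compat|].
      replace (h * h * (T * T + 1) * (C * C)) with (h * h) by (rewrite Rmult_assoc, EC; ring).
      replace (h * h + ax * ax) with (N * N) by (rewrite EN; ring). lra. }
    assert (0 < T * h) by (apply Rmult_lt_0_compat; lra).
    apply Rsqr_incrst_0; unfold Rsqr; lra.
  - intros (Hi & H).
    assert (Hh : 0 < h).
    { apply Rmult_lt_reg_l with T; lra. }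
    split; [exact Hi|]. split.
    + intros ->. unfold h, dot, vsub in Hh; cbn [fst snd] in Hh. lra.
    + assert (H2 : ax * ax < T * h * (T * h)) by (apply Rmult_le_0_lt_compat; lra).
      apply Rsqr_incrst_0; unfold Rsqr; [|apply Rmult_le_pos; lra|lra].
      replace (h * h) with (h * h * (T * T + 1) * (C * C)) by (rewrite Rmult_assoc, EC; ring).
      replace (N * C * (N * C)) with (N * N * (C * C)) by ring.
      apply Rmult_lt_compat_r; [now apply Rmult_lt_0_compat|]. rewrite EN. lra.
Qed.

Lemma in_cone_dot_pos (n i : nat) (u v : point) : (9 <= n)%nat ->
  in_cone n i u v -> 0 < dot (vsub v u) (bisector n i).
Proof.
  intros Hn H. apply in_cone_iff in H as [_ H]; [|exact Hn].
  pose proof (half_tan_bounds n Hn).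
  pose proof (Rabs_pos (cross (vsub v u) (bisector n i))). nra.
Qed.

(** With [|x| < T h], [bisector_gap] bounds the height in the rotated frame by
    [h (cos + T |sin|) <= h]: a vector is closest to the bisector of its own cone. *)
Lemma in_cone_bisector_max (n j : nat) (u v : point) (z : Z) : (9 <= n)%nat ->
  in_cone n j u v ->
  dot (vsub v u) (bisector n j) * cos (IZR z * cone_angle n) +
  cross (vsub v u) (bisector n j) * sin (IZR z * cone_angle n)
  <= dot (vsub v u) (bisector n j).
Proof.
  intros Hn H. pose proof (in_cone_dot_pos _ _ _ _ Hn H) as Hp.
  apply in_cone_iff in H as [_ H]; [|exact Hn].
  pose proof (bisector_gap n z Hn) as G.
  set (p := dot _ _) in *; set (s := cross _ _) in *.
  set (c := cos _) in *; set (t := sin _) in *.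
  assert (s * t <= Rabs s * Rabs t) by (rewrite <- Rabs_mult; apply Rle_abs).
  pose proof (Rabs_pos t). nra.
Qed.

(** * The cost of a vector in a cone *)

Lemma chain_factor_denom_pos (n : nat) : (9 <= n)%nat ->
  0 < cos (cone_angle n / 2) - sin (3 * cone_angle n / 4).
Proof.
  intros Hn. destruct (cone_angle_bounds n Hn). pose proof PI_RGT_0.
  rewrite <- (cos_shift (3 * cone_angle n / 4)).
  assert (cos (PI / 2 - 3 * cone_angle n / 4) < cos (cone_angle n / 2)); [|lra].
  apply cos_decreasing_1; lra.
Qed.

Lemma chain_factor_ge_1 (n : nat) : (9 <= n)%nat -> 1 <= chain_factor n.
Proof.
  intros Hn. pose proof (chain_factor_denom_pos n Hn) as Hd.
  destruct (cone_angle_bounds n Hn). pose proof PI_RGT_0.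
  unfold chain_factor. apply Rmult_le_reg_r with (1 := Hd).
  replace (cos (cone_angle n / 4) / (cos (cone_angle n / 2) - sin (3 * cone_angle n / 4)) *
    (cos (cone_angle n / 2) - sin (3 * cone_angle n / 4)))
    with (cos (cone_angle n / 4)) by (field; lra).
  assert (cos (cone_angle n / 2) <= cos (cone_angle n / 4)) by (apply cos_decr_1; lra).
  assert (0 <= sin (3 * cone_angle n / 4)) by (apply sin_ge_0; lra).
  lra.
Qed.

(* [chain_factor] is [sin s / cos (s + theta/2)] at the largest half-sum
   [s = pi/4 + theta/8] that [cone_cost_angle] meets. *)
Lemma chain_factor_eq (n : nat) : (9 <= n)%nat ->
  chain_factor n * cos (PI / 4 + cone_angle n / 8 + cone_angle n / 2)
  = sin (PI / 4 + cone_angle n / 8).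
Proof.
  intros Hn. pose proof (chain_factor_denom_pos n Hn) as Hd.
  unfold chain_factor.
  set (t := cone_angle n) in *.
  apply Rmult_eq_reg_r with (cos (t / 2) - sin (3 * t / 4)); [|lra].
  replace (cos (t / 4) / (cos (t / 2) - sin (3 * t / 4)) *
    cos (PI / 4 + t / 8 + t / 2) * (cos (t / 2) - sin (3 * t / 4)))
    with (cos (t / 4) * cos (PI / 4 + t / 8 + t / 2)) by (field; lra).
  assert (E1 : cos (t / 4) = 2 * sin (PI / 4 - t / 8) * cos (PI / 4 - t / 8)).
  { rewrite <- sin_2a, <- (sin_shift (t / 4)). f_equal. lra. }
  assert (E2 : sin (PI / 4 + t / 8) = cos (PI / 4 - t / 8)).
  { rewrite <- (cos_shift (PI / 4 + t / 8)). f_equal. lra. }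
  assert (E3 : cos (PI / 4 + t / 8 + t / 2) = sin (PI / 4 - 5 * t / 8)).
  { rewrite <- (sin_shift (PI / 4 + t / 8 + t / 2)). f_equal. lra. }
  assert (E4 : cos (t / 2) - sin (3 * t / 4) =
    2 * sin (PI / 4 - t / 8) * sin (PI / 4 - 5 * t / 8)).
  { rewrite <- (cos_shift (3 * t / 4)), form2.
    replace ((t / 2 - (PI / 2 - 3 * t / 4)) / 2) with (- (PI / 4 - 5 * t / 8)) by field.
    replace ((t / 2 + (PI / 2 - 3 * t / 4)) / 2) with (PI / 4 - t / 8) by field.
    rewrite sin_neg. ring. }
  rewrite E1, E2, E3, E4. ring.
Qed.

(** Multiplied by [cos (theta/2)], the cost of a unit vector at angle [y] is
    [cos y + F sin (y + theta/2)]. Sum-to-product formulas reduce the comparison to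
    [sin s <= F cos (s + theta/2)] for [s = (f + a) / 2]. This is hardest at the largest admissible
    [s], where [chain_factor_eq] gives equality. *)
Lemma cone_cost_angle (n : nat) (a f : R) : (9 <= n)%nat ->
  0 <= a <= f -> f + a <= PI / 2 + cone_angle n / 4 ->
  cos a / cos (cone_angle n / 2) + chain_factor n * (half_tan n * cos a + sin a) <=
  cos f / cos (cone_angle n / 2) + chain_factor n * (half_tan n * cos f + sin f).
Proof.
  intros Hn Ha Hf.
  pose proof (half_cos_pos n Hn) as Hc. pose proof (half_tan_mul_cos n Hn) as ET.
  pose proof (chain_factor_eq n Hn) as EF. pose proof (chain_factor_ge_1 n Hn) as HF.
  destruct (cone_angle_bounds n Hn) as [Ht0 Ht1]. pose proof PI_RGT_0.
  set (t := cone_angle n) in *. set (F := chain_factor n) in *.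
  assert (E : forall y, (cos y / cos (t / 2) + F * (half_tan n * cos y + sin y)) * cos (t / 2)
    = cos y + F * sin (y + t / 2)).
  { intros y. rewrite sin_plus, <- ET. field. lra. }
  apply Rmult_le_reg_r with (1 := Hc). rewrite !E.
  assert (D1 : cos a - cos f = 2 * sin ((f - a) / 2) * sin ((f + a) / 2)).
  { rewrite form2. replace ((a - f) / 2) with (- ((f - a) / 2)) by field.
    replace ((a + f) / 2) with ((f + a) / 2) by field. rewrite sin_neg. ring. }
  assert (D2 : sin (f + t / 2) - sin (a + t / 2) =
    2 * cos ((f + a) / 2 + t / 2) * sin ((f - a) / 2)).
  { rewrite form4. replace ((f + t / 2 - (a + t / 2)) / 2) with ((f - a) / 2) by field.
    replace ((f + t / 2 + (a + t / 2)) / 2) with ((f + a) / 2 + t / 2) by field. ring. }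
  assert (G1 : 0 <= sin ((f - a) / 2)) by (apply sin_ge_0; lra).
  assert (G2 : sin ((f + a) / 2) <= sin (PI / 4 + t / 8)) by (apply sin_incr_1; lra).
  assert (G3 : cos (PI / 4 + t / 8 + t / 2) <= cos ((f + a) / 2 + t / 2))
    by (apply cos_decr_1; lra).
  assert (G4 : sin ((f + a) / 2) <= F * cos ((f + a) / 2 + t / 2)) by nra.
  nra.
Qed.

(** The bound of the theorem for the vector [v], with [|v| cos alpha] and [|v| sin alpha] replaced
    by the height and the unsigned offset of [v] in the frame of cone [i]. *)
Definition cone_cost (n i : nat) (v : point) : R :=
  dot v (bisector n i) / cos (cone_angle n / 2) +
  chain_factor n * (half_tan n * dot v (bisector n i) + Rabs (cross v (bisector n i))).

Lemma cos_sin_acos_bisector (n i : nat) (v : point) :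
  0 < norm v ->
  cos (acos (dot v (bisector n i) / norm v)) * norm v = dot v (bisector n i) /\
  sin (acos (dot v (bisector n i) / norm v)) * norm v = Rabs (cross v (bisector n i)).
Proof.
  intros HN. pose proof (norm_sqr v) as EN. rewrite (dot_self_bisector n i) in EN.
  set (h := dot v (bisector n i)) in *. set (x := cross v (bisector n i)) in *.
  assert (Hb : -1 <= h / norm v <= 1).
  { split; apply Rmult_le_reg_r with (1 := HN); unfold Rdiv;
      rewrite Rmult_assoc, Rinv_l by lra; nra. }
  rewrite cos_acos by exact Hb. split; [field; lra|].
  rewrite sin_acos by exact Hb.
  rewrite <- (sqrt_Rsqr (norm v)) at 2 by lra.
  rewrite <- sqrt_mult_alt.
  - rewrite <- sqrt_Rsqr_abs. f_equal. unfold Rsqr.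
    replace ((1 - h / norm v * (h / norm v)) * (norm v * norm v))
      with (norm v * norm v - h * h) by (field; lra).
    rewrite EN. ring.
  - assert (h / norm v * (h / norm v) <= 1); unfold Rsqr; nra.
Qed.

(** Let [e] and [f] be the angles of [v] with the bisectors of [C_j] and [C_i]. Then [e <= f], as
    the bisector of its own cone is closest, and [cone_cost_angle] applies once
    [f + e <= pi/2 + theta/4]. That follows from [e <= theta/2] unless [f] exceeds [pi/2 - theta/4];
    then the form [4k + 5] of [n] provides a bisector near [v]. *)
Lemma cone_cost_le (k i j : nat) (a b : point) : (1 <= k)%nat ->
  in_cone (4 * k + 5) j a b ->
  0 <= dot (vsub b a) (bisector (4 * k + 5) i) ->
  cone_cost (4 * k + 5) j (vsub b a) <= cone_cost (4 * k + 5) i (vsub b a).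
Proof.
  intros Hk Hj Hh.
  assert (Hn : (9 <= 4 * k + 5)%nat) by lia.
  assert (En : INR (4 * k + 5) = 4 * INR k + 5)
    by (rewrite plus_INR, mult_INR; simpl; ring).
  pose proof (cone_angle_mul (4 * k + 5) ltac:(lia)) as E2. rewrite En in E2.
  set (n := (4 * k + 5)%nat) in *.
  assert (Hab : b <> a) by (destruct Hj as (_ & H & _); exact H).
  pose proof (norm_vsub_pos _ _ Hab) as HN.
  pose proof (proj2 (proj2 Hj)) as Hcone.
  destruct (cone_angle_bounds n Hn) as [Ht0 Ht1].
  set (v := vsub b a) in *.
  (* Here [z] counts cone steps from the bisector of [C_i], hence the shift by [i - j] when the
     maximality of the bisector of [C_j] is used. *)
  assert (Hmax : forall z, dot v (bisector n i) * cos (IZR z * cone_angle n) +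
    cross v (bisector n i) * sin (IZR z * cone_angle n) <= dot v (bisector n j)).
  { intros z.
    pose proof (in_cone_bisector_max n j a b (z + (Z.of_nat i - Z.of_nat j)) Hn Hj) as G.
    fold v in G. eapply Rle_trans; [|exact G]. apply Req_le.
    rewrite plus_IZR, minus_IZR, <- !INR_IZR_INZ.
    unfold dot, cross, bisector; cbn [fst snd].
    replace (INR i * cone_angle n)
      with (INR j * cone_angle n + (INR i - INR j) * cone_angle n) by ring.
    replace ((IZR z + (INR i - INR j)) * cone_angle n)
      with (IZR z * cone_angle n + (INR i - INR j) * cone_angle n) by ring.
    rewrite !sin_plus, !cos_plus. ring. }
  destruct (cos_sin_acos_bisector n i v HN) as [Ci Si].
  destruct (cos_sin_acos_bisector n j v HN) as [Cj Sj].
  set (f := acos (dot v (bisector n i) / norm v)) in *.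
  set (e := acos (dot v (bisector n j) / norm v)) in *.
  assert (Bf : 0 <= f <= PI) by apply acos_bound.
  assert (Be : 0 <= e <= PI) by apply acos_bound.
  pose proof PI_RGT_0.
  assert (Hf2 : f <= PI / 2).
  { destruct (Rle_dec f (PI / 2)); [assumption|exfalso].
    assert (cos f < 0) by (apply cos_lt_0; lra). nra. }
  assert (Hef : e <= f).
  { destruct (Rle_dec e f); [assumption|exfalso].
    assert (cos e < cos f) by (apply cos_decreasing_1; lra).
    pose proof (Hmax 0%Z) as G. rewrite Rmult_0_l, cos_0, sin_0 in G. nra. }
  assert (He : e <= cone_angle n / 2).
  { destruct (Rle_dec e (cone_angle n / 2)); [assumption|exfalso].
    assert (cos e < cos (cone_angle n / 2)) by (apply cos_decreasing_1; lra). nra. }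
  assert (Hs : f + e <= PI / 2 + cone_angle n / 4).
  { destruct (Rle_dec f (PI / 2 - cone_angle n / 4)); [lra|].
    (* the bisector at angle [(k+1) theta = pi/2 - theta/4] on the side of [v]
       is within [theta/4] of [v] *)
    assert (Em : INR (k + 1) * cone_angle n = PI / 2 - cone_angle n / 4)
      by (rewrite plus_INR; simpl; lra).
    assert (G : norm v * cos (f - (PI / 2 - cone_angle n / 4)) <= norm v * cos e).
    { rewrite cos_minus, <- Em.
      rewrite <- (Rmult_comm (cos e)), Cj.
      replace (norm v * (cos f * cos (INR (k + 1) * cone_angle n) +
                         sin f * sin (INR (k + 1) * cone_angle n)))
        with ((cos f * norm v) * cos (INR (k + 1) * cone_angle n) +
              (sin f * norm v) * sin (INR (k + 1) * cone_angle n)) by ring.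
      rewrite Ci, Si.
      unfold Rabs; destruct (Rcase_abs (cross v (bisector n i))).
      - pose proof (Hmax (- Z.of_nat (k + 1))%Z) as G.
        rewrite opp_IZR, <- INR_IZR_INZ, Ropp_mult_distr_l_reverse, cos_neg, sin_neg in G. lra.
      - pose proof (Hmax (Z.of_nat (k + 1))) as G. rewrite <- INR_IZR_INZ in G. lra. }
    destruct (Rle_dec e (f - (PI / 2 - cone_angle n / 4))); [lra|exfalso].
    assert (cos e < cos (f - (PI / 2 - cone_angle n / 4))) by (apply cos_decreasing_1; lra).
    nra. }
  pose proof (cone_cost_angle n e f Hn ltac:(lra) Hs) as G.
  unfold cone_cost. rewrite <- Ci, <- Si, <- Cj, <- Sj.
  apply Rmult_le_compat_r with (r := norm v) in G; [|lra].
  unfold Rdiv in *. lra.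
Qed.

(** In the frame of [C_j] the height is at most [(h2 - h1) (C + T q) + 2 T q h1] with [q = |sin|].
    The first term is at most [h2 - h1] by [bisector_gap], the second is below [h1] because
    [T < 1/2]. *)
Lemma edge_proj_lt (n i j : nat) (v : point) (h1 h2 : R) : (9 <= n)%nat ->
  0 < h1 < h2 ->
  dot v (bisector n i) = h2 - h1 ->
  Rabs (cross v (bisector n i)) <= half_tan n * (h1 + h2) ->
  dot v (bisector n j) < h2.
Proof.
  intros Hn Hh Ed Ex. rewrite (dot_bisector_shift n j i v), Ed.
  pose proof (bisector_gap n (Z.of_nat j - Z.of_nat i) Hn) as G.
  pose proof (half_tan_bounds n Hn) as HT.
  set (C := cos _) in *. set (x := cross _ _) in *.
  assert (Hs1 : Rabs (sin (IZR (Z.of_nat j - Z.of_nat i) * cone_angle n)) <= 1).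
  { apply Rabs_le. apply SIN_bound. }
  set (s := sin _) in *.
  assert (H1 : x * s <= half_tan n * (h1 + h2) * Rabs s).
  { apply Rle_trans with (Rabs x * Rabs s).
    - rewrite <- Rabs_mult. apply Rle_abs.
    - apply Rmult_le_compat_r; [apply Rabs_pos|exact Ex]. }
  pose proof (Rabs_pos s) as H0. set (q := Rabs s) in *. set (T := half_tan n) in *.
  assert (H2 : T * q < / 2) by nra.
  assert (H3 : (h2 - h1) * (C + T * q) <= h2 - h1) by nra.
  nra.
Qed.

Lemma polar_angle (v : point) : 0 < norm v ->
  exists t, 0 <= t < 2 * PI /\ fst v = norm v * sin t /\ snd v = norm v * cos t.
Proof.
  intros HN. pose proof PI_RGT_0 as HPI.
  assert (E : norm v * norm v = fst v ^ 2 + snd v ^ 2)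
    by (rewrite norm_sqr; unfold dot; ring).
  (* [bisector 1 0] is the upward vertical, so the arccosine is the unsigned angle from it; left of
     the vertical the clockwise angle is [2 pi - t]. *)
  destruct (cos_sin_acos_bisector 1 0 v HN) as [C S].
  assert (E1 : dot v (bisector 1 0) = snd v).
  { unfold dot, bisector; simpl. rewrite Rmult_0_l, cos_0, sin_0. ring. }
  assert (E2 : cross v (bisector 1 0) = fst v).
  { unfold cross, bisector; simpl. rewrite Rmult_0_l, cos_0, sin_0. ring. }
  rewrite E1 in C, S. rewrite E2 in S.
  set (t := acos (snd v / norm v)) in *.
  assert (Bt : 0 <= t <= PI) by apply acos_bound.
  destruct (Rle_dec 0 (fst v)) as [Hf|Hf].
  - exists t. rewrite Rabs_pos_eq in S by exact Hf. split; [lra|]. lra.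
  - exists (2 * PI - t). rewrite Rabs_left in S by lra.
    assert (t <> 0) by (intros Et; rewrite Et, sin_0 in S; lra).
    split; [lra|].
    rewrite sin_minus, cos_minus, cos_2PI, sin_2PI. lra.
Qed.

Lemma in_some_cone (n : nat) (a b : point) : (9 <= n)%nat -> b <> a ->
  (forall j, (j < n)%nat -> cross (vsub b a) (ray_dir n j) <> 0) ->
  exists j, in_cone n j a b.
Proof.
  intros Hn Hab HR. pose proof (norm_vsub_pos _ _ Hab) as HN.
  destruct (polar_angle _ HN) as (t & Ht & E1 & E2).
  destruct (cone_angle_bounds n Hn) as [Ht0 Ht1].
  pose proof (cone_angle_mul n ltac:(lia)) as En. pose proof PI_RGT_0 as HPI.
  (* The floor of [y] rounds [t / theta] to the nearest cone index; a tie would put the direction on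
     a ray, against the hypothesis. *)
  pose (y := t / cone_angle n + / 2).
  assert (Ey : (y - / 2) * cone_angle n = t) by (unfold y; field; lra).
  pose (m := Z.to_nat (up y - 1)).
  destruct (archimed y) as [Hu1 Hu2].
  assert (Hup : (0 < up y)%Z).
  { apply lt_IZR. assert (0 < y) by nra. lra. }
  assert (Hm : INR m <= y < INR m + 1).
  { unfold m. rewrite INR_IZR_INZ, Z2Nat.id, minus_IZR by lia. lra. }
  assert (Hm2 : INR m <> y).
  { intros Em. destruct m as [|m'].
    - simpl in Em. nra.
    - rewrite S_INR in Em.
      apply (HR m').
      + apply INR_lt. nra.
      + unfold cross, ray_dir. cbn [fst snd]. rewrite E1, E2.
        replace ((INR m' + / 2) * cone_angle n) with t by (rewrite <- Ey, <- Em; field).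
        ring. }
  assert (Hcos : cos (cone_angle n / 2) < cos (t - INR m * cone_angle n)).
  { destruct (Rle_dec 0 (t - INR m * cone_angle n)).
    - apply cos_decreasing_1; nra.
    - rewrite <- (cos_neg (t - _)). apply cos_decreasing_1; nra. }
  (* Directions just short of a full turn round up to [m = n], which is cone [0] again. *)
  assert (Hper : exists j, (j < n)%nat /\
    cos (t - INR m * cone_angle n) = cos (t - INR j * cone_angle n)).
  { destruct (Nat.lt_ge_cases m n) as [Hlt|Hge]; [now exists m|].
    assert (m = n).
    { apply Nat.le_antisymm; [|exact Hge]. apply Nat.lt_succ_r, INR_lt. rewrite S_INR. nra. }
    subst m. exists 0%nat. split; [lia|]. rewrite H, En. simpl INR.
    rewrite Rmult_0_l, Rminus_0_r, cos_minus, cos_2PI, sin_2PI. ring. }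
  destruct Hper as (j & Hj & Ej). exists j.
  split; [exact Hj|]. split; [exact Hab|].
  unfold dot, bisector; cbn [fst snd]. rewrite E1, E2.
  rewrite Ej, cos_minus in Hcos. nra.
Qed.

(** * Visibility in a triangle *)

Lemma finite_argmin {A : Type} (P : list A) (Q : A -> Prop) (f : A -> R) :
  (exists a, In a P /\ Q a) ->
  exists a, In a P /\ Q a /\ forall b, In b P -> Q b -> f a <= f b.
Proof.
  induction P as [|x P IH]; intros (a & Ha & Qa); [destruct Ha|].
  destruct (classic (exists b, In b P /\ Q b)) as [Hex|Hno].
  - destruct (IH Hex) as (m & Hm & Qm & Hmin).
    destruct (classic (Q x /\ f x < f m)) as [[Qx Hlt]|Hx].
    + exists x. split; [now left|]. split; [exact Qx|].
      intros b [<-|Hb] Qb; [lra|]. specialize (Hmin b Hb Qb). lra.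
    + exists m. split; [now right|]. split; [exact Qm|].
      intros b [<-|Hb] Qb; [|now apply Hmin].
      apply Rnot_lt_le. intros Hlt. now apply Hx.
  - exists x.
    assert (Qx : Q x).
    { destruct Ha as [->|Ha]; [exact Qa|]. exfalso. apply Hno. now exists a. }
    split; [now left|]. split; [exact Qx|].
    intros b [<-|Hb] Qb; [lra|]. exfalso. apply Hno. now exists b.
Qed.

Lemma finite_rank_ind {A : Type} (P : list A) (f : A -> R) (Q : A -> Prop) :
  (forall x, In x P -> (forall y, In y P -> f y < f x -> Q y) -> Q x) ->
  forall x, In x P -> Q x.
Proof.
  intros Hstep x Hx. apply NNPP. intros HnQ.
  destruct (finite_argmin P (fun y => ~ Q y) f) as (m & Hm & HnQm & Hmin);
    [now exists x|].
  apply HnQm, Hstep; [exact Hm|]. intros y Hy Hlt. apply NNPP. intros HnQy.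
  specialize (Hmin y Hy HnQy). lra.
Qed.

(** * Affine functions and signed orientations *)

Definition affine (f : point -> R) : Prop :=
  exists a b c, forall z, f z = a + b * fst z + c * snd z.

Definition lerp (a b : point) (t : R) : point :=
  (fst a + t * (fst b - fst a), snd a + t * (snd b - snd a)).

(** The sign [s], equal to [1] or [-1], mirrors the plane, so that one argument serves for points on
    either side of [uw]. *)
Definition sgn_orient (s : R) (a b c : point) : R := s * orient a b c.

Ltac unfold_plane :=
  unfold sgn_orient, orient, lerp, cross, dot, vsub in *; cbn [fst snd] in *.

Lemma sgn_orient_affine (s : R) (a b : point) : affine (sgn_orient s a b).
Proof.
  exists (s * (- (fst b - fst a) * snd a + (snd b - snd a) * fst a)),
    (- s * (snd b - snd a)), (s * (fst b - fst a)).
  intros z. unfold_plane. ring.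
Qed.

Lemma affine_lerp (f : point -> R) (a b : point) (t : R) :
  affine f -> f (lerp a b t) = (1 - t) * f a + t * f b.
Proof. intros (x & y & z & Hf). rewrite !Hf. unfold_plane. ring. Qed.

(** The orientations on the right are the barycentric coordinates of [z] in the triangle [u w p],
    scaled by twice its signed area. *)
Lemma affine_barycentric (f : point -> R) (s : R) (u w p z : point) : affine f ->
  f z * sgn_orient s u w p =
  f p * sgn_orient s u w z + f w * sgn_orient s p u z + f u * sgn_orient s w p z.
Proof. intros (x & y & c & Hf). rewrite !Hf. unfold_plane. ring. Qed.

(** This expresses [r - q] through [w - q] and [q - p]; with positive coefficients, monotonicity of
    [f] along the chain passes to the points still ahead. *)
Lemma affine_turn (f : point -> R) (s : R) (p q r w : point) : affine f ->
  (f r - f q) * sgn_orient s p q w =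
  (f w - f q) * sgn_orient s p q r + (f q - f p) * sgn_orient s w q r.
Proof. intros (x & y & c & Hf). rewrite !Hf. unfold_plane. ring. Qed.

Lemma sgn_orient_rot (s : R) (a b c : point) : sgn_orient s a b c = sgn_orient s b c a.
Proof. unfold_plane. ring. Qed.

Lemma sgn_orient_swap (s : R) (a b c : point) : sgn_orient s a b c = - sgn_orient s b a c.
Proof. unfold_plane. ring. Qed.

Lemma sgn_orient_l (s : R) (a b : point) : sgn_orient s a b a = 0.
Proof. unfold_plane. ring. Qed.

Lemma sgn_orient_r (s : R) (a b : point) : sgn_orient s a b b = 0.
Proof. unfold_plane. ring. Qed.

Lemma sgn_orient_mul (s : R) (a b c a' b' c' : point) : s * s = 1 ->
  sgn_orient s a b c * sgn_orient s a' b' c' = orient a b c * orient a' b' c'.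
Proof. intros Hs. unfold sgn_orient. replace (orient a b c * orient a' b' c')
  with ((s * s) * (orient a b c * orient a' b' c')) by (rewrite Hs; ring). ring. Qed.

Definition no_three_collinear (P : list point) : Prop :=
  forall a b c, In a P -> In b P -> In c P -> a <> b -> a <> c -> b <> c ->
    orient a b c <> 0.

Lemma sgn_orient_neq_0 (s : R) (P : list point) (a b c : point) : s * s = 1 ->
  no_three_collinear P -> In a P -> In b P -> In c P ->
  a <> b -> a <> c -> b <> c -> sgn_orient s a b c <> 0.
Proof.
  intros Hs HP Ha Hb Hc Hab Hac Hbc. unfold sgn_orient.
  apply Rmult_integral_contrapositive_currified.
  - intros ->. lra.
  - now apply HP.
Qed.

Definition inside (s : R) (u w p z : point) : Prop :=
  0 < sgn_orient s u w z /\ 0 < sgn_orient s w p z /\ 0 < sgn_orient s p u z.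

Lemma inside_orient_pos (s : R) (u w p z : point) :
  inside s u w p z -> 0 < sgn_orient s u w p.
Proof.
  intros (H1 & H2 & H3).
  replace (sgn_orient s u w p)
    with (sgn_orient s u w z + sgn_orient s w p z + sgn_orient s p u z)
    by (unfold_plane; ring). lra.
Qed.

Lemma inside_affine_pos (f : point -> R) (s : R) (u w p z : point) :
  affine f -> inside s u w p z ->
  0 <= f u -> 0 <= f w -> 0 <= f p -> 0 < f u + f w + f p -> 0 < f z.
Proof.
  intros Hf Hin Hu Hw Hp Hsum. pose proof (inside_orient_pos _ _ _ _ _ Hin) as HD.
  destruct Hin as (H1 & H2 & H3).
  pose proof (affine_barycentric f s u w p z Hf) as E.
  pose proof (Rmult_le_pos _ _ Hu (Rlt_le _ _ H2)).
  pose proof (Rmult_le_pos _ _ Hw (Rlt_le _ _ H3)).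
  pose proof (Rmult_le_pos _ _ Hp (Rlt_le _ _ H1)).
  apply Rmult_lt_reg_r with (1 := HD). rewrite Rmult_0_l, E.
  destruct (Rlt_dec 0 (f u)); [|destruct (Rlt_dec 0 (f w))].
  - pose proof (Rmult_lt_0_compat _ _ r H2). lra.
  - pose proof (Rmult_lt_0_compat _ _ r H3). lra.
  - assert (r : 0 < f p) by lra. pose proof (Rmult_lt_0_compat _ _ r H1). lra.
Qed.

Lemma inside_trans (s : R) (u w p q r : point) :
  inside s u w p q -> inside s u w q r -> inside s u w p r.
Proof.
  intros Hq Hr. pose proof (inside_orient_pos _ _ _ _ _ Hq) as HD.
  split; [apply Hr|]. destruct Hq as (Q1 & Q2 & Q3).
  split; apply (inside_affine_pos _ s u w q r (sgn_orient_affine _ _ _) Hr).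
  all: rewrite ?sgn_orient_l, ?sgn_orient_r.
  all: try rewrite <- (sgn_orient_rot s u w p).
  all: try rewrite (sgn_orient_rot s p u w).
  all: lra.
Qed.

(** A step of gift wrapping: [q] is the first candidate met by the ray from [p] through [u] as it
    turns towards [w]. The absence of collinear triples makes the turn strict. *)
Lemma first_hull_vertex (s : R) (P : list point) (u w p : point) : s * s = 1 ->
  no_three_collinear P -> In w P -> In p P -> p <> w ->
  0 < sgn_orient s u w p ->
  exists q, In q P /\ (q = w \/ inside s u w p q) /\
    forall r, In r P -> r = w \/ inside s u w p r -> r <> q -> 0 < sgn_orient s p q r.
Proof.
  intros Hs HP Hw Hp Hpw HD.
  assert (HDw : 0 < sgn_orient s p u w) by (now rewrite sgn_orient_rot).
  (* the ratio of the two orientations decreases with the angle [u p z] *)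
  destruct (finite_argmin P (fun z => z = w \/ inside s u w p z)
    (fun z => - (sgn_orient s w p z / sgn_orient s p u z))) as (q & Hq & Aq & Hmin).
  { exists w. split; [exact Hw|now left]. }
  exists q. split; [exact Hq|]. split; [exact Aq|].
  intros r Hr Ar Hrq. specialize (Hmin r Hr Ar).
  assert (Ga : forall z, z = w \/ inside s u w p z -> 0 < sgn_orient s p u z /\ z <> p).
  { intros z [->|(I1 & I2 & I3)]; [auto|]. split; [exact I3|].
    intros ->. rewrite sgn_orient_l in I3. lra. }
  destruct (Ga q Aq) as [Gq Hqp]. destruct (Ga r Ar) as [Gr Hrp].
  assert (Hle : sgn_orient s w p r * sgn_orient s p u q <=
                sgn_orient s w p q * sgn_orient s p u r).
  { replace (sgn_orient s w p r * sgn_orient s p u q) with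
      (sgn_orient s w p r / sgn_orient s p u r * (sgn_orient s p u r * sgn_orient s p u q))
      by (field; lra).
    replace (sgn_orient s w p q * sgn_orient s p u r) with
      (sgn_orient s w p q / sgn_orient s p u q * (sgn_orient s p u r * sgn_orient s p u q))
      by (field; lra).
    apply Rmult_le_compat_r; [|lra]. apply Rlt_le, Rmult_lt_0_compat; assumption. }
  assert (E : sgn_orient s p q r * sgn_orient s u w p =
    sgn_orient s w p q * sgn_orient s p u r - sgn_orient s w p r * sgn_orient s p u q)
    by (unfold_plane; ring).
  assert (Hnz : sgn_orient s p q r <> 0)
    by (apply (sgn_orient_neq_0 s P); auto).
  assert (0 <= sgn_orient s p q r).
  { apply Rmult_le_reg_r with (1 := HD). lra. }
  lra.
Qed.

(** * Constraints and the visibility of hull vertices *)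

Definition unobstructed (S : list (point * point)) (a b : point) : Prop :=
  forall c d, is_constraint S c d -> ~ proper_intersect a b c d.

Lemma proper_intersect_swap (a b c d : point) :
  proper_intersect a b c d -> proper_intersect a b d c.
Proof.
  intros [H1 H2]. split; [lra|].
  replace (orient d c a) with (- orient c d a) by (unfold_plane; ring).
  replace (orient d c b) with (- orient c d b) by (unfold_plane; ring). lra.
Qed.

Lemma proper_intersect_swap_l (a b c d : point) :
  proper_intersect a b c d -> proper_intersect b a c d.
Proof.
  intros [H1 H2]. split; [|lra].
  replace (orient b a c) with (- orient a b c) by (unfold_plane; ring).
  replace (orient b a d) with (- orient a b d) by (unfold_plane; ring). lra.
Qed.

(** A constraint segment is properly crossed by no constraint, so both alternatives of [can_see]
    lead to the same condition. *)
Lemma can_see_unobstructed (P : list point) (S : list (point * point)) (a b : point) :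
  valid_constraints P S -> can_see S a b <-> unobstructed S a b.
Proof.
  intros [_ HV]. split.
  - intros Hsee.
    assert (G : forall c d, In (c, d) S -> ~ proper_intersect a b c d).
    { intros c d Hcd. destruct Hsee as [[Hab|Hab]|Hsee].
      - exact (HV (a, b) (c, d) Hab Hcd).
      - intros HI. apply proper_intersect_swap_l in HI. exact (HV (b, a) (c, d) Hab Hcd HI).
      - exact (Hsee (c, d) Hcd). }
    intros c d [Hcd|Hcd]; [now apply G|].
    intros HI. apply (G d c Hcd). now apply proper_intersect_swap.
  - intros H. right. intros [c d] Hcd. apply H. now left.
Qed.

Lemma is_constraint_sym (S : list (point * point)) (a b : point) :
  is_constraint S a b -> is_constraint S b a.
Proof. unfold is_constraint. tauto. Qed.

Lemma is_constraint_ends (P : list point) (S : list (point * point)) (a b : point) :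
  valid_constraints P S -> is_constraint S a b -> In a P /\ In b P /\ a <> b.
Proof.
  intros [HV _] [H|H]; destruct (HV _ H) as (H1 & H2 & H3); cbn [fst snd] in *; auto.
Qed.

(** Along [ab] the orientation relative to [cd] is affine and changes sign, so it vanishes at the
    parameter [x / (x - y)] formed from its end values [x], [y]; likewise along [cd]. The two
    denominators are opposite, which makes the points coincide. *)
Lemma proper_intersect_point (a b c d : point) : proper_intersect a b c d ->
  exists r t, 0 < r < 1 /\ 0 < t < 1 /\ lerp a b r = lerp c d t.
Proof.
  intros [H1 H2].
  assert (Frac : forall x y, x * y < 0 -> x - y <> 0 /\ 0 < x / (x - y) < 1).
  { intros x y Hxy.
    assert (Hne : x - y <> 0) by (intros E; assert (x = y) by lra; subst; nra).
    split; [exact Hne|].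
    assert (Hsq : 0 < (x - y) * (x - y)) by (apply Rsqr_pos_lt; exact Hne).
    split.
    - replace (x / (x - y)) with (x * (x - y) / ((x - y) * (x - y))) by (field; exact Hne).
      apply Rdiv_lt_0_compat; nra.
    - assert (0 < 1 - x / (x - y)); [|lra].
      replace (1 - x / (x - y)) with (- y * (x - y) / ((x - y) * (x - y)))
        by (field; exact Hne).
      apply Rdiv_lt_0_compat; nra. }
  destruct (Frac _ _ H1) as [N1 B1]. destruct (Frac _ _ H2) as [N2 B2].
  exists (orient c d a / (orient c d a - orient c d b)),
    (orient a b c / (orient a b c - orient a b d)).
  split; [exact B2|]. split; [exact B1|].
  assert (E : orient c d a - orient c d b = - (orient a b c - orient a b d))
    by (unfold_plane; ring).
  rewrite E. clear B1 B2 N2.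
  set (D := orient a b c - orient a b d) in *.
  unfold lerp. f_equal.
  - apply Rmult_eq_reg_r with D; [|exact N1].
    transitivity (fst a * D - orient c d a * (fst b - fst a)); [field; lra|].
    transitivity (fst c * D + orient a b c * (fst d - fst c)); [|field; exact N1].
    unfold D. unfold_plane. ring.
  - apply Rmult_eq_reg_r with D; [|exact N1].
    transitivity (snd a * D - orient c d a * (snd b - snd a)); [field; lra|].
    transitivity (snd c * D + orient a b c * (snd d - snd c)); [|field; exact N1].
    unfold D. unfold_plane. ring.
Qed.

(** Going back from [t] to [0], [y] is the parameter at which the first of the two affine functions
    vanishes. *)
Lemma first_exit (f0 f1 g0 g1 t : R) : 0 < t -> 0 < f0 + t * f1 -> 0 < g0 + t * g1 ->
  f0 <= 0 -> exists y, 0 <= y < t /\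
    (f0 + y * f1 = 0 /\ 0 <= g0 + y * g1 \/ g0 + y * g1 = 0 /\ 0 <= f0 + y * f1).
Proof.
  intros Ht Hf Hg Hf0.
  assert (Zero : forall a0 a1, 0 < a0 + t * a1 -> a0 <= 0 ->
    exists y, 0 < a1 /\ 0 <= y < t /\ a0 + y * a1 = 0).
  { intros a0 a1 Ha Ha0. assert (Ha1 : 0 < a1) by nra.
    assert (E : a0 + - a0 / a1 * a1 = 0) by (field; lra).
    exists (- a0 / a1). split; [exact Ha1|]. split; [|exact E].
    split.
    - apply Rmult_le_pos; [lra|]. left. now apply Rinv_0_lt_compat.
    - apply Rmult_lt_reg_r with (1 := Ha1). lra. }
  destruct (Zero _ _ Hf Hf0) as (y & Hf1 & Hy & Ey).
  destruct (Rle_dec 0 (g0 + y * g1)) as [G|G].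
  - exists y. auto.
  - assert (Hg1 : 0 < g1) by nra.
    assert (Hg0 : g0 <= 0) by nra.
    destruct (Zero _ _ Hg Hg0) as (y' & _ & Hy' & Ey').
    exists y'. split; [exact Hy'|]. right. split; [exact Ey'|].
    assert (y < y') by nra. nra.
Qed.

(** Where an affine function vanishes on a segment, its end values [x] and [y] balance with weights
    [k] and [g]; a positive weight on a nonzero value forces opposite signs. *)
Lemma mul_neg_of_balance (x y g k : R) :
  0 <= g -> 0 < k -> x <> 0 -> y * g = - (x * k) -> x * y < 0.
Proof.
  intros Hg Hk Hx E. pose proof (Rsqr_pos_lt x Hx) as Hx2. unfold Rsqr in Hx2.
  pose proof (Rmult_lt_0_compat _ _ Hx2 Hk) as Hxk.
  assert (Exy : x * y * g = - (x * x * k)) by (rewrite Rmult_assoc, E; ring).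
  apply Rnot_le_lt. intros Hxy. pose proof (Rmult_le_pos _ _ Hxy Hg). lra.
Qed.

(* A constraint with a point in the pocket of the triangle [u w p] cut off by the
   line [pq] on the side of [u] must leave the pocket through [up] or [uw] if its
   end [c] lies on the side of [u]. *)
Lemma pocket_no_constraint (s : R) (P : list point) (u w p q c d : point) (t : R) :
  s * s = 1 -> no_three_collinear P ->
  In u P -> In w P -> In p P -> In c P -> In d P -> c <> d -> c <> u -> d <> u ->
  u <> w -> u <> p ->
  ~ proper_intersect u p c d -> ~ proper_intersect u w c d ->
  0 < sgn_orient s u w p ->
  sgn_orient s p q u < 0 -> 0 <= sgn_orient s p q w -> sgn_orient s p q c < 0 ->
  ~ (0 < sgn_orient s u w c /\ 0 < sgn_orient s p u c) ->
  0 < t < 1 ->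
  0 < sgn_orient s u w (lerp c d t) -> 0 < sgn_orient s p u (lerp c d t) ->
  sgn_orient s p q (lerp c d t) <= 0 -> False.
Proof.
  intros Hs HP Hu Hw Hp Hc Hd Hcd Hcu Hdu Huw Hup Nup Nuw HD Qu Qw Qc Hout Ht XF XG XQ.
  assert (Hcw : c <> w) by (intros ->; lra).
  assert (Hcp : c <> p) by (intros ->; rewrite sgn_orient_l in Qc; lra).
  assert (L : forall a b y, sgn_orient s a b (lerp c d y) =
    sgn_orient s a b c + y * (sgn_orient s a b d - sgn_orient s a b c)).
  { intros a b y. rewrite (affine_lerp _ c d y (sgn_orient_affine s a b)). ring. }
  assert (Hexit : exists y, 0 <= y < t /\
    (sgn_orient s u w (lerp c d y) = 0 /\ 0 <= sgn_orient s p u (lerp c d y) \/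
     sgn_orient s p u (lerp c d y) = 0 /\ 0 <= sgn_orient s u w (lerp c d y))).
  { rewrite L in XF, XG.
    destruct (Rle_dec (sgn_orient s u w c) 0) as [Hf|Hf].
    - destruct (first_exit _ _ _ _ t ltac:(lra) XF XG Hf) as (y & Hy & Hd').
      exists y. rewrite !L. auto.
    - destruct (Rle_dec (sgn_orient s p u c) 0) as [Hg|Hg].
      + destruct (first_exit _ _ _ _ t ltac:(lra) XG XF Hg) as (y & Hy & Hd').
        exists y. rewrite !L. split; [exact Hy|]. tauto.
      + exfalso. apply Hout. lra. }
  destruct Hexit as (y & Hy & Hz).
  (* The constraint starts strictly on the side of [u] at [c] and has not crossed [pq] before
     [t]. *)
  assert (ZQ : sgn_orient s p q (lerp c d y) < 0).
  { rewrite L in *. nra. }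
  assert (Zcd : sgn_orient s c d (lerp c d y) = 0)
    by (rewrite L, sgn_orient_l, sgn_orient_r; ring).
  assert (Ncd : sgn_orient s c d u <> 0) by (apply (sgn_orient_neq_0 s P); auto).
  pose proof (affine_barycentric _ s u w p (lerp c d y) (sgn_orient_affine s c d)) as E1.
  pose proof (affine_barycentric _ s u w p (lerp c d y) (sgn_orient_affine s p q)) as E2.
  rewrite Zcd, Rmult_0_l in E1. rewrite sgn_orient_l, Rmult_0_l in E2.
  assert (E2' : sgn_orient s p q (lerp c d y) * sgn_orient s u w p < 0) by nra.
  rewrite E2 in E2'.
  set (F := sgn_orient s u w (lerp c d y)) in *.
  set (G := sgn_orient s p u (lerp c d y)) in *.
  set (K := sgn_orient s w p (lerp c d y)) in *.
  set (Ou := sgn_orient s c d u) in *.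
  assert (HG : 0 <= G) by (destruct Hz; lra).
  assert (HF : 0 <= F) by (destruct Hz; lra).
  (* The exit point is strictly on the side of [u], while [w] and [p] are not, so its barycentric
     weight at [u] is positive: it is neither [w] nor [p]. *)
  assert (HK : 0 < K).
  { pose proof (Rmult_le_pos _ _ Qw HG). nra. }
  assert (Slope : forall a b, sgn_orient s a b (lerp c d y) = 0 ->
    0 < sgn_orient s a b (lerp c d t) -> sgn_orient s a b c <> 0 ->
    sgn_orient s a b c * sgn_orient s a b d < 0).
  { intros a b Z0 X0 Hne. rewrite L in Z0, X0.
    set (A := sgn_orient s a b c) in *. set (B := sgn_orient s a b d) in *.
    assert (0 < B - A) by nra. assert (A <= 0) by nra. nra. }
  (* In both cases the crossing is proper: [Slope] puts [c] and [d] on opposite sides of the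
     triangle side, and [E1] puts the ends of that side on opposite sides of [cd]. *)
  destruct Hz as [[Z0 _]|[Z0 _]].
  - apply Nuw. split.
    + rewrite <- (sgn_orient_mul s) by exact Hs.
      apply Slope; [exact Z0|exact XF|]. apply (sgn_orient_neq_0 s P); auto.
    + rewrite <- (sgn_orient_mul s) by exact Hs. fold Ou.
      set (Ow := sgn_orient s c d w) in *.
      rewrite Z0, Rmult_0_r, Rplus_0_l in E1.
      assert (EG : Ow * G = - (Ou * K)) by lra.
      exact (mul_neg_of_balance _ _ _ _ HG HK Ncd EG).
  - apply Nup. split.
    + rewrite <- (sgn_orient_mul s) by exact Hs.
      rewrite (sgn_orient_swap s u p c), (sgn_orient_swap s u p d).
      replace (- sgn_orient s p u c * - sgn_orient s p u d)
        with (sgn_orient s p u c * sgn_orient s p u d) by ring.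
      apply Slope; [exact Z0|exact XG|]. apply (sgn_orient_neq_0 s P); auto.
    + rewrite <- (sgn_orient_mul s) by exact Hs. fold Ou.
      set (Op := sgn_orient s c d p) in *.
      rewrite Z0, Rmult_0_r in E1.
      assert (EG : Op * F = - (Ou * K)) by lra.
      exact (mul_neg_of_balance _ _ _ _ HF HK Ncd EG).
Qed.

(** A constraint crossing [pq] or [uq] has an end on the side of [u] of the line [pq]. By the choice
    of [q] this end is outside the pocket, unless it is [u], which is ruled out because no
    constraint of [u] enters the angle [w u p]. Hence [pocket_no_constraint] applies. *)
Lemma first_hull_vertex_visible (s : R) (P : list point) (S : list (point * point))
    (u w p q : point) :
  s * s = 1 -> no_three_collinear P -> valid_constraints P S ->
  In u P -> In w P -> In p P -> In q P -> u <> w -> u <> p ->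
  unobstructed S u w -> unobstructed S u p ->
  0 < sgn_orient s u w p ->
  (forall z, is_constraint S u z -> ~ (0 < sgn_orient s u w z /\ 0 < sgn_orient s p u z)) ->
  q = w \/ inside s u w p q ->
  (forall r, In r P -> r = w \/ inside s u w p r -> r <> q -> 0 < sgn_orient s p q r) ->
  unobstructed S p q /\ unobstructed S u q.
Proof.
  intros Hs HP HV Hu Hw Hp Hq Huw Hup Suw Sup HD HN Aq Hhull.
  assert (HDw : 0 < sgn_orient s p u w) by (now rewrite sgn_orient_rot).
  assert (Gq : 0 < sgn_orient s p u q) by (destruct Aq as [->|(_ & _ & I)]; assumption).
  assert (Fq : 0 <= sgn_orient s u w q).
  { destruct Aq as [->|(I & _ & _)]; [rewrite sgn_orient_r|]; lra. }
  assert (Qu : sgn_orient s p q u < 0).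
  { rewrite 2!sgn_orient_rot, sgn_orient_swap in Gq. rewrite sgn_orient_rot. unfold_plane. lra. }
  assert (Qw : 0 <= sgn_orient s p q w).
  { destruct (classic (w = q)) as [<-|Hne]; [rewrite sgn_orient_r; lra|].
    left. apply Hhull; auto. }
  (* A vertex in the angle at [u] and on the side of [u] of [pq] would lie in the triangle [u w p],
     against the choice of [q]. *)
  assert (Hempty : forall c, In c P -> sgn_orient s p q c < 0 ->
    ~ (0 < sgn_orient s u w c /\ 0 < sgn_orient s p u c)).
  { intros c Hc Qc [Fc Gc].
    assert (Hcq : c <> q) by (intros ->; rewrite sgn_orient_r in Qc; lra).
    assert (E : sgn_orient s p u q * sgn_orient s w p c =
      - (sgn_orient s u w p * sgn_orient s p q c) + sgn_orient s p u c * sgn_orient s p q w)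
      by (unfold_plane; ring).
    assert (Kc : 0 < sgn_orient s w p c).
    { apply Rmult_lt_reg_l with (1 := Gq). rewrite Rmult_0_r, E.
      pose proof (Rmult_le_pos _ _ (Rlt_le _ _ Gc) Qw). nra. }
    assert (0 < sgn_orient s p q c); [|lra].
    apply Hhull; auto. right. repeat split; assumption. }
  assert (Hcore : forall c d t, is_constraint S c d -> c <> u -> d <> u ->
    sgn_orient s p q c < 0 -> 0 < t < 1 ->
    0 < sgn_orient s u w (lerp c d t) -> 0 < sgn_orient s p u (lerp c d t) ->
    sgn_orient s p q (lerp c d t) <= 0 -> False).
  { intros c d t Hcd Hcu Hdu Qc Ht XF XG XQ.
    destruct (is_constraint_ends P S c d HV Hcd) as (Hc & Hd & Hne).
    eapply (pocket_no_constraint s P u w p q c d t); eauto. }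
  assert (La : forall a b c d t, sgn_orient s a b (lerp c d t) =
    (1 - t) * sgn_orient s a b c + t * sgn_orient s a b d)
    by (intros; apply affine_lerp, sgn_orient_affine).
  split.
  - assert (Half : forall c d, is_constraint S c d -> proper_intersect p q c d ->
      sgn_orient s p q c < 0 -> False).
    { intros c d Hcd HI Qc.
      destruct (proper_intersect_point _ _ _ _ HI) as (r & t & Hr & Ht & EX).
      assert (XF : 0 < sgn_orient s u w (lerp c d t)) by (rewrite <- EX, La; nra).
      assert (XG : 0 < sgn_orient s p u (lerp c d t))
        by (rewrite <- EX, La, sgn_orient_l; nra).
      assert (XQ : sgn_orient s p q (lerp c d t) = 0)
        by (rewrite <- EX, La, sgn_orient_l, sgn_orient_r; ring).
      assert (Qd : 0 < sgn_orient s p q d) by (rewrite La in XQ; nra).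
      assert (Hdu : d <> u) by (intros ->; lra).
      destruct (classic (c = u)) as [->|Hcu].
      - apply (HN d Hcd). rewrite La in XF, XG.
        rewrite sgn_orient_l in XF. rewrite sgn_orient_r in XG. split; nra.
      - apply (Hcore c d t); auto. lra. }
    intros c d Hcd HI.
    destruct (Rlt_dec (sgn_orient s p q c) 0) as [Qc|Qc]; [now apply (Half c d)|].
    apply (Half d c).
    + now apply is_constraint_sym.
    + now apply proper_intersect_swap.
    + destruct HI as [HI _]. rewrite <- (sgn_orient_mul s) in HI by exact Hs. nra.
  - destruct Aq as [->|(Fq' & _ & _)]; [exact Suw|].
    assert (Half : forall c d, is_constraint S c d -> proper_intersect u q c d ->
      sgn_orient s p q c < 0 -> False).
    { intros c d Hcd HI Qc.
      destruct (proper_intersect_point _ _ _ _ HI) as (r & t & Hr & Ht & EX).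
      assert (Hcu : c <> u).
      { intros ->. destruct HI as [HI _].
        replace (orient u q u) with 0 in HI by (unfold_plane; ring). lra. }
      assert (Hdu : d <> u).
      { intros ->. destruct HI as [HI _].
        replace (orient u q u) with 0 in HI by (unfold_plane; ring). lra. }
      apply (Hcore c d t); auto; rewrite <- EX, La, ?sgn_orient_l, ?sgn_orient_r; nra. }
    intros c d Hcd HI.
    destruct (Rlt_dec (sgn_orient s p q c) 0) as [Qc|Qc]; [now apply (Half c d)|].
    apply (Half d c).
    + now apply is_constraint_sym.
    + now apply proper_intersect_swap.
    + destruct (proper_intersect_point _ _ _ _ HI) as (r & t & Hr & Ht & EX).
      pose proof (f_equal (sgn_orient s p q) EX) as EQ.
      rewrite !La, sgn_orient_r in EQ. nra.
Qed.

(** * Convex chains *)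

Definition reach (G : point -> point -> Prop) (a b : point) (L : R) : Prop :=
  exists l, is_path G a l /\ last l a = b /\ path_length a l <= L.

Lemma last_cons {A : Type} (x d : A) (l : list A) : last (x :: l) d = last l x.
Proof.
  revert x d. induction l as [|y l IH]; intros x d; [reflexivity|].
  change (last (y :: l) d = last (y :: l) x). now rewrite !IH.
Qed.

Lemma path_app (G : point -> point -> Prop) (l1 l2 : list point) (a : point) :
  is_path G a l1 -> is_path G (last l1 a) l2 ->
  is_path G a (l1 ++ l2) /\ last (l1 ++ l2) a = last l2 (last l1 a) /\
  path_length a (l1 ++ l2) = path_length a l1 + path_length (last l1 a) l2.
Proof.
  revert a. induction l1 as [|x l1 IH]; intros a H1 H2.
  - simpl in *. split; [exact H2|]. split; [reflexivity|ring].
  - destruct H1 as [Hx H1]. rewrite last_cons in H2 |- *.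
    destruct (IH x H1 H2) as (I1 & I2 & I3).
    cbn [app]. rewrite last_cons. cbn [is_path path_length].
    rewrite I2, I3. split; [auto|]. split; [reflexivity|ring].
Qed.

Lemma reach_trans (G : point -> point -> Prop) (a b c : point) (L1 L2 : R) :
  reach G a b L1 -> reach G b c L2 -> reach G a c (L1 + L2).
Proof.
  intros (l1 & P1 & E1 & B1) (l2 & P2 & E2 & B2). subst b.
  destruct (path_app G l1 l2 a P1 P2) as (Q1 & Q2 & Q3).
  exists (l1 ++ l2). rewrite Q2, Q3. split; [exact Q1|]. split; [exact E2|lra].
Qed.

Lemma reach_weaken (G : point -> point -> Prop) (a b : point) (L L' : R) :
  reach G a b L -> L <= L' -> reach G a b L'.
Proof. intros (l & H1 & H2 & H3) HL. exists l. split; [|split]; auto. lra. Qed.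

Lemma reach_edge (G : point -> point -> Prop) (a b : point) :
  G a b -> reach G a b (pdist a b).
Proof. intros H. exists (b :: nil). simpl. repeat split; auto. lra. Qed.

(* The chain turns towards the [X]-decreasing side, so its [X]-coordinate first
   increases and then decreases; to the right of the axis it cannot decrease,
   as it stays to the left of [uw].  Hence the two bounds on its total
   [X]-variation. *)
Lemma convex_chain_reach (G : point -> point -> Prop) (s K c T : R)
    (X H : point -> R) (P : list point) (S : list (point * point)) (u w : point) :
  s * s = 1 -> 0 <= c -> affine X -> affine H -> X u = 0 -> H u = 0 ->
  (forall a b d, sgn_orient s a b d =
     (X b - X a) * (H d - H a) - (H b - H a) * (X d - X a)) ->
  no_three_collinear P -> valid_constraints P S ->
  In u P -> In w P -> u <> w -> unobstructed S u w ->
  0 < T -> Rabs (X w) < T * H w ->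
  (forall a b, In a P -> In b P -> a <> b -> unobstructed S a b ->
     0 < H a < H b -> H b <= H w -> Rabs (X a) < T * H a -> Rabs (X b) < T * H b ->
     reach G a b (K * (H b - H a) + c * Rabs (X b - X a))) ->
  forall p, In p P ->
  0 < sgn_orient s u w p -> 0 < H p < H w -> Rabs (X p) < T * H p ->
  unobstructed S u p ->
  (forall z, is_constraint S u z -> ~ (0 < sgn_orient s u w z /\ 0 < sgn_orient s p u z)) ->
  (forall r, In r P -> inside s u w p r -> H p < H r) ->
  reach G p w (K * (H w - H p) + c * (Rabs (X w) + Rabs (X p))).
Proof.
  intros Hs Hc AX AH Xu Hu0 Hdet HP HV Hu Hw Huw Suw HT Cw Hstep.
  assert (Main : forall p, In p P ->
    0 < sgn_orient s u w p -> 0 < H p < H w -> Rabs (X p) < T * H p ->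
    unobstructed S u p ->
    (forall z, is_constraint S u z ->
       ~ (0 < sgn_orient s u w z /\ 0 < sgn_orient s p u z)) ->
    (forall r, In r P -> inside s u w p r -> H p < H r) ->
    reach G p w (K * (H w - H p) +
      c * ((if Rle_dec 0 (X p) then X w else Rabs (X w)) - X p)) /\
    (X w <= X p -> (forall r, In r P -> inside s u w p r -> X r <= X p) ->
      reach G p w (K * (H w - H p) + c * (X p - X w)))).
  (* The rank is twice the area of the triangle [u w p], which decreases when [p] is replaced by the
     next hull vertex inside it. *)
  { refine (finite_rank_ind P (fun p => sgn_orient s u w p) _ _).
    intros p Hp IH HD Hhp Cp Sup HN Hup.
    assert (Hpw : p <> w) by (intros ->; rewrite sgn_orient_r in HD; lra).
    assert (Hpu : u <> p) by (intros <-; rewrite sgn_orient_l in HD; lra).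
    (* Lying to the left of [uw] means [X p / H p < X w / H w], and [H p < H w]. *)
    assert (Right : 0 <= X p -> X p < X w).
    { intros Xp. rewrite Hdet, Xu, Hu0 in HD. nra. }
    destruct (first_hull_vertex s P u w p Hs HP Hw Hp Hpw HD) as (q & Hq & Aq & Hhull).
    destruct (first_hull_vertex_visible s P S u w p q) as [Spq Suq]; auto.
    destruct Aq as [->|Iq].
    { assert (R0 : reach G p w (K * (H w - H p) + c * Rabs (X w - X p)))
        by (apply Hstep; auto; lra).
      split.
      - apply (reach_weaken _ _ _ _ _ R0). apply Rplus_le_compat_l, Rmult_le_compat_l; [lra|].
        destruct (Rle_dec 0 (X p)) as [Xp|Xp].
        + rewrite Rabs_pos_eq; [lra|]. specialize (Right Xp). lra.
        + unfold Rabs; destruct (Rcase_abs (X w - X p)), (Rcase_abs (X w)); lra.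
      - intros Hle _. rewrite Rabs_left1, Ropp_minus_distr in R0 by lra. exact R0. }
    assert (HDq : 0 < sgn_orient s u w q) by apply Iq.
    assert (Hqw : w <> q) by (intros <-; rewrite sgn_orient_r in HDq; lra).
    assert (Hqp : p <> q).
    { intros <-. destruct Iq as (_ & I & _). rewrite sgn_orient_r in I. lra. }
    assert (Hhq : H p < H q) by (apply Hup; auto).
    assert (Hhw : H q < H w).
    { assert (0 < H w - H q); [|lra].
      apply (inside_affine_pos (fun z => H w - H z) s u w p q); auto; try lra.
      destruct AH as (a0 & a1 & a2 & EH). exists (H w - a0), (- a1), (- a2).
      intros z. rewrite (EH z). ring. }
    assert (Cq : Rabs (X q) < T * H q).
    { apply Rabs_def2 in Cp, Cw.
      destruct AH as (a0 & a1 & a2 & EH). destruct AX as (b0 & b1 & b2 & EX).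
      apply Rabs_def1.
      - assert (0 < T * H q - X q); [|lra].
        apply (inside_affine_pos (fun z => T * H z - X z) s u w p q); auto;
          rewrite ?Xu, ?Hu0; try lra.
        exists (T * a0 - b0), (T * a1 - b1), (T * a2 - b2).
        intros z. rewrite EH, EX. ring.
      - assert (0 < T * H q + X q); [|lra].
        apply (inside_affine_pos (fun z => T * H z + X z) s u w p q); auto;
          rewrite ?Xu, ?Hu0; try lra.
        exists (T * a0 + b0), (T * a1 + b1), (T * a2 + b2).
        intros z. rewrite EH, EX. ring. }
    assert (Tw : 0 < sgn_orient s p q w) by (apply Hhull; auto).
    assert (Tr : forall r, In r P -> inside s u w q r ->
      0 < sgn_orient s p q r /\ 0 < sgn_orient s w q r).
    { intros r Hr Ir. split; [|apply Ir]. apply Hhull; auto.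
      - right. now apply (inside_trans s u w p q r).
      - intros ->. destruct Ir as (_ & I & _). rewrite sgn_orient_r in I. lra. }
    assert (Hstep1 : reach G p q (K * (H q - H p) + c * Rabs (X q - X p)))
      by (apply Hstep; auto; lra).
    assert (HDlt : sgn_orient s u w q < sgn_orient s u w p).
    { destruct Iq as (I1 & I2 & I3).
      assert (sgn_orient s u w p =
        sgn_orient s u w q + sgn_orient s w p q + sgn_orient s p u q)
        by (unfold_plane; ring). lra. }
    assert (HNq : forall z, is_constraint S u z ->
      ~ (0 < sgn_orient s u w z /\ 0 < sgn_orient s q u z)).
    { intros z Hz [Z1 Z2]. apply (HN z Hz). split; [exact Z1|].
      destruct Iq as (I1 & I2 & I3).
      assert (E : sgn_orient s p u z * sgn_orient s u w q =
        sgn_orient s p u q * sgn_orient s u w z + sgn_orient s u w p * sgn_orient s q u z)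
        by (unfold_plane; ring).
      apply Rmult_lt_reg_r with (1 := HDq). rewrite Rmult_0_l, E.
      pose proof (Rmult_lt_0_compat _ _ I3 Z1). pose proof (Rmult_lt_0_compat _ _ HD Z2). lra. }
    (* By [affine_turn] the points ahead are higher than [q], since both [w - q] and [q - p]
       rise. *)
    assert (Hupq : forall r, In r P -> inside s u w q r -> H q < H r).
    { intros r Hr Ir. destruct (Tr r Hr Ir) as [T1 T2].
      pose proof (affine_turn H s p q r w AH) as E.
      assert (0 < H r - H q); [|lra].
      apply Rmult_lt_reg_r with (1 := Tw). rewrite Rmult_0_l, E.
      apply Rplus_lt_0_compat; apply Rmult_lt_0_compat; lra. }
    destruct (IH q Hq HDlt HDq ltac:(lra) Cq Suq HNq Hupq) as [IHg IHl].
    (* Once a chain edge does not increase [X], convexity makes all later ones decrease it, and the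
       second bound of the induction hypothesis applies. *)
    assert (Left : X q <= X p ->
      X w < X q /\ reach G p w (K * (H w - H p) + c * (X p - X w))).
    { intros Hle.
      assert (Hw' : X w < X q).
      { rewrite Hdet in Tw.
        assert (E : (X q - X p) * (H w - H p) - (H q - H p) * (X w - X p) =
          (X q - X p) * (H w - H q) - (H q - H p) * (X w - X q)) by ring.
        rewrite E in Tw. nra. }
      split; [exact Hw'|].
      assert (R2 : reach G q w (K * (H w - H q) + c * (X q - X w))).
      { apply IHl; [lra|]. intros r Hr Ir. destruct (Tr r Hr Ir) as [T1 T2].
        pose proof (affine_turn X s p q r w AX) as E.
        apply Rnot_lt_le. intros Hlt.
        assert (0 < (X r - X q) * sgn_orient s p q w) by (apply Rmult_lt_0_compat; lra).
        rewrite E in H0. nra. }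
      rewrite Rabs_left1 in Hstep1 by lra.
      apply (reach_weaken _ _ _ _ _ (reach_trans _ _ _ _ _ _ Hstep1 R2)).
      apply Req_le. ring. }
    split.
    - destruct (Rle_dec (X q) (X p)) as [Hle|Hgt].
      + destruct (Left Hle) as [Hw' R2]. apply (reach_weaken _ _ _ _ _ R2).
        apply Rplus_le_compat_l, Rmult_le_compat_l; [lra|].
        destruct (Rle_dec 0 (X p)) as [Xp|Xp]; [specialize (Right Xp); lra|].
        pose proof (Rle_abs (- X w)) as Ha. rewrite Rabs_Ropp in Ha. lra.
      + rewrite Rabs_pos_eq in Hstep1 by lra.
        apply (reach_weaken _ _ _ _ _ (reach_trans _ _ _ _ _ _ Hstep1 IHg)).
        match goal with |- ?a + c * ?b + (?d + c * ?e) <= _ =>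
          replace (a + c * b + (d + c * e)) with ((a + d) + c * (b + e)) by ring end.
        apply Rplus_le_compat; [apply Req_le; ring|]. apply Rmult_le_compat_l; [lra|].
        pose proof (Rle_abs (X w)).
        destruct (Rle_dec 0 (X q)), (Rle_dec 0 (X p)); lra.
    - intros Hle Hall. apply Left. apply Hall; auto. }
  intros p Hp HD Hhp Cp Sup HN Hup.
  destruct (Main p Hp HD Hhp Cp Sup HN Hup) as [R0 _].
  apply (reach_weaken _ _ _ _ _ R0). apply Rplus_le_compat_l, Rmult_le_compat_l; [lra|].
  pose proof (Rle_abs (X w)). pose proof (Rle_abs (- X p)) as Ha. rewrite Rabs_Ropp in Ha.
  destruct (Rle_dec 0 (X p)); lra.
Qed.

(** * The path between two visible points *)

(** One step size for finitely many strict inequalities, so that a direction can be perturbed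
    without violating any of them. *)
Lemma small_positive (L : list (R * R)) :
  exists e, 0 < e /\ forall a b, In (a, b) L -> 0 < a -> e * Rabs b < a.
Proof.
  induction L as [|[a b] L (e & He & IH)].
  - exists 1. split; [lra|]. intros a b [].
  - pose proof (Rabs_pos b) as Hb.
    destruct (Rlt_dec 0 a) as [Ha|Ha].
    + assert (He2 : 0 < a / (Rabs b + 1)) by (apply Rdiv_lt_0_compat; lra).
      exists (Rmin e (a / (Rabs b + 1))). split; [now apply Rmin_glb_lt|].
      intros a' b' [E|Hin] Ha'.
      * injection E as <- <-.
        apply Rle_lt_trans with (a / (Rabs b + 1) * Rabs b).
        -- apply Rmult_le_compat_r; [exact Hb|apply Rmin_r].
        -- assert (E : a = a / (Rabs b + 1) * Rabs b + a / (Rabs b + 1)) by (field; lra).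
           lra.
      * apply Rle_lt_trans with (e * Rabs b'); [|now apply IH].
        apply Rmult_le_compat_r; [apply Rabs_pos|apply Rmin_l].
    + exists e. split; [exact He|]. intros a' b' [E|Hin] Ha'; [|now apply IH].
      injection E as <- <-. lra.
Qed.

Lemma vsub_add (u d : point) : vsub (fst u + fst d, snd u + snd d) u = d.
Proof. destruct u, d. unfold vsub; cbn [fst snd]. f_equal; ring. Qed.

(* If [uw] is itself a constraint, [w] is on the boundary of its subcone, so the
   direction of [w] has to be rotated slightly to designate one. *)
Lemma subcone_exists (n i : nat) (P : list point) (S : list (point * point)) (u w : point) :
  (9 <= n)%nat -> no_three_collinear P -> valid_constraints P S ->
  In u P -> In w P -> in_cone n i u w ->
  exists d, subcone_dir S n i u d /\ in_subcone S n i u d w.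
Proof.
  intros Hn HP HV Hu Hw Hcone.
  assert (Hwu : w <> u) by apply Hcone.
  pose proof (vsub_dot_pos u w Hwu) as Hpos.
  pose proof Hcone as Hc'. apply in_cone_iff in Hc' as [Hi Hc']; [|exact Hn].
  apply Rabs_def2 in Hc'.
  set (v := vsub w u) in *. set (b := bisector n i) in *. set (T := half_tan n) in *.
  set (v' := (- snd v, fst v)).
  (* [v'] is [v] turned by a right angle. The first two pairs keep the perturbed direction in the
     cone; the others keep its side relative to the direction of each vertex not in line with
     [v]. *)
  destruct (small_positive
    ((T * dot v b - cross v b, T * dot v' b - cross v' b) ::
     (T * dot v b + cross v b, T * dot v' b + cross v' b) ::
     map (fun z => (Rabs (cross (vsub z u) v), dot (vsub z u) v)) P)) as (e & He & Hsmall).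
  set (d := (fst v + e * fst v', snd v + e * snd v')).
  assert (Hz : forall z, In z P -> z <> u -> z <> w ->
    0 < cross (vsub z u) v * cross (vsub z u) d).
  { intros z Hz Hzu Hzw.
    assert (Hne : cross (vsub z u) v <> 0).
    { intros E. apply (HP u z w); auto. }
    assert (Hsm : e * Rabs (dot (vsub z u) v) < Rabs (cross (vsub z u) v)).
    { apply Hsmall; [|now apply Rabs_pos_lt]. right; right.
      apply (in_map (fun z => (Rabs (cross (vsub z u) v), dot (vsub z u) v))). exact Hz. }
    replace (cross (vsub z u) d) with (cross (vsub z u) v + e * dot (vsub z u) v)
      by (unfold d, v', cross, dot; cbn [fst snd]; ring).
    set (A := cross (vsub z u) v) in *. set (B := dot (vsub z u) v) in *.
    assert (Hy : Rabs (e * B) < Rabs A)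
      by (rewrite Rabs_mult, (Rabs_pos_eq e) by lra; exact Hsm).
    apply Rabs_def2 in Hy. unfold Rabs in Hy. destruct (Rcase_abs A).
    - apply Rmult_neg_neg; lra.
    - apply Rmult_lt_0_compat; lra. }
  assert (Hw2 : cross v d = e * dot v v)
    by (unfold d, v', cross, dot; cbn [fst snd]; ring).
  exists d. split; split.
  - apply in_cone_iff; [exact Hn|]. rewrite vsub_add. fold b T. split; [exact Hi|].
    assert (S1 : e * Rabs (T * dot v' b - cross v' b) < T * dot v b - cross v b)
      by (apply Hsmall; [now left|lra]).
    assert (S2 : e * Rabs (T * dot v' b + cross v' b) < T * dot v b + cross v b)
      by (apply Hsmall; [right; now left|lra]).
    assert (Neg : forall y, - (e * Rabs y) <= e * y).
    { intros y. pose proof (Rle_abs (- y)) as Hy. rewrite Rabs_Ropp in Hy. nra. }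
    pose proof (Neg (T * dot v' b - cross v' b)). pose proof (Neg (T * dot v' b + cross v' b)).
    replace (cross d b) with (cross v b + e * cross v' b)
      by (unfold d, cross, dot; cbn [fst snd]; ring).
    replace (dot d b) with (dot v b + e * dot v' b)
      by (unfold d, cross, dot; cbn [fst snd]; ring).
    apply Rabs_def1; lra.
  - intros z Hcz _ E. destruct (is_constraint_ends P S u z HV Hcz) as (_ & Hz' & Hne).
    destruct (classic (z = w)) as [->|Hzw].
    + fold v in E. rewrite Hw2 in E. nra.
    + specialize (Hz z Hz' (not_eq_sym Hne) Hzw). rewrite E in Hz. lra.
  - exact Hcone.
  - intros (z & Hcz & _ & Hsep). destruct (is_constraint_ends P S u z HV Hcz) as (_ & Hz' & Hne).
    fold v in Hsep. destruct (classic (z = w)) as [->|Hzw].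
    + fold v in Hsep. replace (cross v v) with 0 in Hsep by (unfold cross; ring). lra.
    + specialize (Hz z Hz' (not_eq_sym Hne) Hzw). lra.
Qed.

Lemma cross_frame_affine (s : R) (u b : point) : affine (fun z => s * cross (vsub z u) b).
Proof.
  exists (s * (- fst u * snd b + snd u * fst b)), (s * snd b), (- s * fst b).
  intros z. unfold_plane. ring.
Qed.

Lemma dot_frame_affine (u b : point) : affine (fun z => dot (vsub z u) b).
Proof.
  exists (- fst u * fst b - snd u * snd b), (fst b), (snd b).
  intros z. unfold_plane. ring.
Qed.

Lemma bisector_unit (n i : nat) : fst (bisector n i) ^ 2 + snd (bisector n i) ^ 2 = 1.
Proof.
  unfold bisector; cbn [fst snd].
  pose proof (sin2_cos2 (INR i * cone_angle n)) as E. unfold Rsqr in E. lra.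
Qed.

(** The cross and dot products with the unit bisector are coordinates in an orthonormal frame, in
    which the orientation is a determinant; [s] mirrors the first coordinate. *)
Lemma sgn_orient_frame (n i : nat) (s : R) (u a b d : point) :
  sgn_orient s a b d =
  (s * cross (vsub b u) (bisector n i) - s * cross (vsub a u) (bisector n i)) *
  (dot (vsub d u) (bisector n i) - dot (vsub a u) (bisector n i)) -
  (dot (vsub b u) (bisector n i) - dot (vsub a u) (bisector n i)) *
  (s * cross (vsub d u) (bisector n i) - s * cross (vsub a u) (bisector n i)).
Proof.
  pose proof (bisector_unit n i) as E. destruct (bisector n i) as [bx by_].
  unfold_plane.
  match goal with |- ?l = _ => transitivity (l * (bx ^ 2 + by_ ^ 2)) end.
  - rewrite E. ring.
  - ring.
Qed.

(** The detour from [u] to a corner of the canonical triangle and along the opposite side to [v] has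
    length [h / cos (theta/2) + (T h - |x|)]. As [chain_factor] is at least [1], it may multiply the
    second term. *)
Lemma pdist_le_corner (n i : nat) (u v : point) : (9 <= n)%nat -> in_cone n i u v ->
  pdist u v <=
  (/ cos (cone_angle n / 2) + chain_factor n * half_tan n) * dot (vsub v u) (bisector n i) -
  chain_factor n * Rabs (cross (vsub v u) (bisector n i)).
Proof.
  intros Hn Hc. pose proof (in_cone_dot_pos _ _ _ _ Hn Hc) as Hh.
  apply in_cone_iff in Hc as [_ Hx]; [|exact Hn].
  pose proof (half_cos_pos n Hn) as Hcos. pose proof (half_tan_bounds n Hn) as HT.
  pose proof (half_tan_mul_cos n Hn) as ET. pose proof (chain_factor_ge_1 n Hn) as HF.
  pose proof (sin2_cos2 (cone_angle n / 2)) as E1. unfold Rsqr in E1. rewrite <- ET in E1.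
  unfold pdist, norm. rewrite (dot_self_bisector n i), <- (pow2_abs (cross _ _)).
  pose proof (Rabs_pos (cross (vsub v u) (bisector n i))) as Hx0.
  set (x := Rabs _) in *. set (h := dot _ _) in *. set (C := cos _) in *.
  set (T := half_tan n) in *. set (F := chain_factor n) in *.
  assert (HA0 : 0 < / C) by now apply Rinv_0_lt_compat.
  assert (HA : / C * / C = 1 + T * T).
  { apply Rmult_eq_reg_r with (C * C); [|nra].
    transitivity 1; [field; lra|]. rewrite <- E1 at 1. ring. }
  apply Rle_trans with (/ C * h + (T * h - x)).
  - assert (0 < / C * h) by nra.
    rewrite <- (sqrt_Rsqr (/ C * h + (T * h - x))) by lra.
    apply sqrt_le_1_alt. unfold Rsqr.
    replace ((/ C * h + (T * h - x)) * (/ C * h + (T * h - x)))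
      with (/ C * / C * (h * h) + 2 * (/ C * h) * (T * h - x) + (T * h - x) * (T * h - x))
      by ring.
    rewrite HA.
    assert (0 <= (/ C * h) * (T * h - x)) by (apply Rmult_le_pos; lra).
    assert (x * x <= T * h * (T * h)) by (apply Rmult_le_compat; lra).
    pose proof (Rle_0_sqr (T * h - x)) as Hq. unfold Rsqr in Hq. lra.
  - assert (0 <= (F - 1) * (T * h - x)) by (apply Rmult_le_pos; lra). lra.
Qed.

Lemma visible_pair_reach (k : nat) (P : list point) (S : list (point * point)) :
  (1 <= k)%nat -> valid_constraints P S -> general_position (4 * k + 5) P ->
  forall (u w : point) (i : nat), In u P -> In w P -> can_see S u w ->
  in_cone (4 * k + 5) i u w ->
  reach (theta_adj (4 * k + 5) P S) u w (cone_cost (4 * k + 5) i (vsub w u)).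
Proof.
  intros Hk HV (GP1 & GP2 & HP).
  assert (Hn : (9 <= 4 * k + 5)%nat) by lia.
  fold (no_three_collinear P) in HP.
  pose proof (cone_cost_le k) as Hcost.
  set (n := (4 * k + 5)%nat) in *.
  set (G := theta_adj n P S).
  (* Finitely many triples of two points and a cone index, so that the induction can be ranked by
     the height of the canonical triangle. *)
  pose (L := list_prod (list_prod P P) (seq 0 n)).
  assert (Ind : forall t, In t L -> can_see S (fst (fst t)) (snd (fst t)) ->
    in_cone n (snd t) (fst (fst t)) (snd (fst t)) ->
    reach G (fst (fst t)) (snd (fst t))
      (cone_cost n (snd t) (vsub (snd (fst t)) (fst (fst t))))).
  2:{ intros u w i Hu Hw Hsee Hc. apply (Ind (u, w, i)); auto.
      apply in_prod; [now apply in_prod|]. apply in_seq. destruct Hc. lia. }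
  refine (finite_rank_ind L (fun t => proj n (snd t) (fst (fst t)) (snd (fst t))) _ _).
  intros [[u w] i] HinL IH0. cbn [fst snd] in *. intros Hsee Hcone.
  apply in_prod_iff in HinL as [HinP _]. apply in_prod_iff in HinP as [Hu Hw].
  assert (IH : forall a b j, In a P -> In b P -> can_see S a b -> in_cone n j a b ->
    proj n j a b < proj n i u w -> reach G a b (cone_cost n j (vsub b a))).
  { intros a b j Ha Hb Hs Hc Hlt. apply (IH0 (a, b, j)); auto.
    apply in_prod; [now apply in_prod|]. apply in_seq. destruct Hc. lia. }
  clear IH0.
  assert (Hwu : w <> u) by apply Hcone.
  pose proof (half_tan_bounds n Hn) as HT. pose proof (chain_factor_ge_1 n Hn) as HF.
  pose proof (half_cos_pos n Hn) as Hcos.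
  set (K := / cos (cone_angle n / 2) + chain_factor n * half_tan n).
  assert (EC : forall j v, cone_cost n j v =
    K * dot v (bisector n j) + chain_factor n * Rabs (cross v (bisector n j))).
  { intros j v. unfold cone_cost, K, Rdiv. ring. }
  destruct (subcone_exists n i P S u w Hn HP HV Hu Hw Hcone) as (d & Hd & Hwd).
  (* [p] is the neighbour [v0] of [u]; it is no higher than [w], which is itself a candidate. *)
  destruct (finite_argmin P (fun v => in_subcone S n i u d v /\ can_see S u v)
    (fun v => proj n i u v)) as (p & Hp & [Hpd Hup] & Hmin); [now exists w|].
  assert (Hpc : in_cone n i u p) by apply Hpd.
  assert (Hpu : p <> u) by apply Hpc.
  assert (Hedge : reach G u p (pdist u p)).
  { apply reach_edge. left. split; [exact Hu|]. split; [exact Hp|].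
    exists i, d. split; [exact Hd|]. split; [exact Hpd|]. split; [exact Hup|]. auto. }
  pose proof (pdist_le_corner n i u p Hn Hpc) as Hlen. fold K in Hlen.
  destruct (classic (p = w)) as [->|Hpw].
  { apply (reach_weaken _ _ _ _ _ Hedge). rewrite EC.
    pose proof (Rmult_le_pos (chain_factor n) _ ltac:(lra)
      (Rabs_pos (cross (vsub w u) (bisector n i)))). lra. }
  assert (Hs : exists s, s * s = 1 /\ 0 < sgn_orient s u w p).
  { assert (orient u w p <> 0) by (apply HP; auto).
    unfold sgn_orient. destruct (Rlt_dec 0 (orient u w p)).
    - exists 1. lra.
    - exists (-1). lra. }
  destruct Hs as (s & Hs & HD).
  set (X := fun z => s * cross (vsub z u) (bisector n i)).
  set (H := fun z => dot (vsub z u) (bisector n i)).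
  assert (AX : affine X) by apply cross_frame_affine.
  assert (AH : affine H) by apply dot_frame_affine.
  assert (Xu : X u = 0) by (unfold X; unfold_plane; ring).
  assert (Hu0 : H u = 0) by (unfold H; unfold_plane; ring).
  assert (Habs : forall y, Rabs (s * y) = Rabs y).
  { intros y. rewrite Rabs_mult.
    assert (Rabs s = 1); [|nra].
    assert (s = 1 \/ s = -1) as [->| ->].
    { assert ((s - 1) * (s + 1) = 0) as E by lra.
      apply Rmult_integral in E. lra. }
    - apply Rabs_R1.
    - rewrite Rabs_left; lra. }
  assert (InC : forall z, in_cone n i u z <-> Rabs (X z) < half_tan n * H z).
  { intros z. unfold X. rewrite Habs, in_cone_iff by exact Hn.
    destruct Hcone. tauto. }
  assert (Hhp : 0 < H p) by (now apply in_cone_dot_pos).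
  assert (Hhpw : H p < H w).
  { assert (H p <= H w) by (apply Hmin; [exact Hw|split; assumption]).
    assert (dot (vsub w p) (bisector n i) <> 0).
    { apply GP2; auto. apply Hcone. }
    assert (H w - H p = dot (vsub w p) (bisector n i)) by (unfold H; unfold_plane; ring).
    lra. }
  assert (Cone : forall z, 0 < sgn_orient s u w z -> 0 < sgn_orient s p u z -> in_cone n i u z).
  { intros z Z1 Z2. apply InC. apply InC in Hcone. apply InC in Hpc.
    apply Rabs_def2 in Hcone, Hpc.
    pose proof (affine_barycentric X s u w p z AX) as EX.
    pose proof (affine_barycentric H s u w p z AH) as EH.
    rewrite Xu in EX. rewrite Hu0 in EH.
    assert (P1 : 0 < (half_tan n * H p - X p) * sgn_orient s u w z)
      by (apply Rmult_lt_0_compat; lra).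
    assert (P2 : 0 < (half_tan n * H w - X w) * sgn_orient s p u z)
      by (apply Rmult_lt_0_compat; lra).
    assert (P3 : 0 < (half_tan n * H p + X p) * sgn_orient s u w z)
      by (apply Rmult_lt_0_compat; lra).
    assert (P4 : 0 < (half_tan n * H w + X w) * sgn_orient s p u z)
      by (apply Rmult_lt_0_compat; lra).
    apply Rabs_def1.
    - assert (0 < half_tan n * H z - X z); [|lra].
      apply Rmult_lt_reg_r with (1 := HD).
      rewrite Rmult_0_l, Rmult_minus_distr_r, Rmult_assoc, EX, EH. lra.
    - assert (0 < half_tan n * H z + X z); [|lra].
      apply Rmult_lt_reg_r with (1 := HD).
      rewrite Rmult_0_l, Rmult_plus_distr_r, Rmult_assoc, EX, EH. lra. }
  (* Since [w] and [p] share a subcone, a constraint of [u] between them would separate one of them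
     from [d]. *)
  assert (HN : forall z, is_constraint S u z ->
    ~ (0 < sgn_orient s u w z /\ 0 < sgn_orient s p u z)).
  { intros z Hz [Z1 Z2]. pose proof (Cone z Z1 Z2) as Cz.
    pose proof (proj2 Hd z Hz Cz) as Hne.
    assert (E1 : sgn_orient s u w z = - (s * cross (vsub z u) (vsub w u))) by (unfold_plane; ring).
    assert (E2 : sgn_orient s p u z = s * cross (vsub z u) (vsub p u)) by (unfold_plane; ring).
    set (c := cross (vsub z u) d) in *.
    assert (N1 : ~ cross (vsub z u) (vsub w u) * c < 0).
    { intros Hlt. apply (proj2 Hwd). exists z. auto. }
    assert (N2 : ~ cross (vsub z u) (vsub p u) * c < 0).
    { intros Hlt. apply (proj2 Hpd). exists z. auto. }
    apply Rnot_lt_le in N1, N2.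
    set (A := cross (vsub z u) (vsub w u)) in *. set (B := cross (vsub z u) (vsub p u)) in *.
    assert (HAB : s * A * (s * B) < 0) by nra.
    assert (A * B < 0) by (replace (s * A * (s * B)) with (s * s * (A * B)) in HAB by ring;
      rewrite Hs in HAB; lra).
    pose proof (Rsqr_pos_lt c Hne) as Hc2. unfold Rsqr in Hc2.
    assert (A * c * (B * c) < 0).
    { replace (A * c * (B * c)) with (A * B * (c * c)) by ring. nra. }
    pose proof (Rmult_le_pos _ _ N1 N2). lra. }
  pose proof (proj1 (can_see_unobstructed P S u w HV) Hsee) as Suw.
  pose proof (proj1 (can_see_unobstructed P S u p HV) Hup) as Sup.
  (* [p] is lowest among the visible points only; the first hull vertex is
     visible, and all other points of the triangle lie above the line to it *)
  assert (Hlow : forall r, In r P -> inside s u w p r -> H p < H r).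
  { destruct (first_hull_vertex s P u w p Hs HP Hw Hp Hpw HD) as (q & Hq & Aq & Hhull).
    destruct (first_hull_vertex_visible s P S u w p q) as [_ Suq]; auto.
    intros r Hr Ir. destruct Aq as [->|Iq].
    { destruct (classic (r = w)) as [->|Hrw].
      - destruct Ir as (I & _ & _). rewrite sgn_orient_r in I. lra.
      - exfalso. pose proof (Hhull r Hr (or_intror Ir) Hrw) as T1.
        rewrite sgn_orient_swap in T1. destruct Ir as (_ & I & _). lra. }
    assert (Hqw : w <> q).
    { intros <-. destruct Iq as (I & _ & _). rewrite sgn_orient_r in I. lra. }
    assert (Hqp : p <> q).
    { intros <-. destruct Iq as (_ & I & _). rewrite sgn_orient_r in I. lra. }
    assert (Cq : in_cone n i u q) by (apply Cone; apply Iq).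
    assert (Hqlow : H p < H q).
    { assert (Hle : H p <= H q).
      { apply Hmin; [exact Hq|]. split; [|now apply (can_see_unobstructed P S u q HV)].
        split; [exact Cq|]. intros (z & Hz & Cz & Hsep).
        assert (N1 : ~ cross (vsub z u) (vsub w u) * cross (vsub z u) d < 0).
        { intros Hlt. apply (proj2 Hwd). exists z. auto. }
        assert (N2 : ~ cross (vsub z u) (vsub p u) * cross (vsub z u) d < 0).
        { intros Hlt. apply (proj2 Hpd). exists z. auto. }
        apply Rnot_lt_le in N1, N2. set (c := cross (vsub z u) d) in *.
        destruct Iq as (I1 & _ & I3).
        (* The direction of [q] is a positive combination of those of [p] and [w], so a constraint
           separating it from [d] would also separate one of these. *)
        assert (E : cross (vsub z u) (vsub q u) * c * sgn_orient s u w p =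
          cross (vsub z u) (vsub p u) * c * sgn_orient s u w q +
          cross (vsub z u) (vsub w u) * c * sgn_orient s p u q)
          by (clearbody c; clear; unfold_plane; ring).
        pose proof (Rmult_le_pos _ _ N2 (Rlt_le _ _ I1)).
        pose proof (Rmult_le_pos _ _ N1 (Rlt_le _ _ I3)). nra. }
      assert (dot (vsub q p) (bisector n i) <> 0) by (apply GP2; auto; apply Hcone).
      assert (H q - H p = dot (vsub q p) (bisector n i)) by (unfold H; unfold_plane; ring).
      lra. }
    destruct (classic (r = q)) as [->|Hrq]; [exact Hqlow|].
    pose proof (Hhull r Hr (or_intror Ir) Hrq) as T1.
    pose proof (Hhull w Hw (or_introl eq_refl) Hqw) as Tw.
    destruct Ir as (_ & T2 & _).
    assert (E : (H r - H p) * sgn_orient s p q w =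
      (H q - H p) * sgn_orient s w p r + (H w - H p) * sgn_orient s p q r).
    { destruct AH as (a0 & a1 & a2 & EH). rewrite !EH. clear. unfold_plane. ring. }
    assert (0 < H r - H p); [|lra].
    apply Rmult_lt_reg_r with (1 := Tw). rewrite Rmult_0_l, E.
    apply Rplus_lt_0_compat; apply Rmult_lt_0_compat; lra. }
  assert (Hchain : reach G p w (K * (H w - H p) + chain_factor n * (Rabs (X w) + Rabs (X p)))).
  { apply (convex_chain_reach G s K (chain_factor n) (half_tan n) X H P S u w); auto;
      try lra; try (now apply InC).
    - intros a b c. apply sgn_orient_frame.
    (* A chain edge is treated in its own cone [C_j]: [edge_proj_lt] makes its canonical triangle
       smaller than that of [uw], and [Hcost] carries the bound over to the frame of [C_i]. *)
    - intros a b Ha Hb Hab Sab Hh Hhb Ca Cb.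
      destruct (in_some_cone n a b Hn) as (j & Cj).
      { intros ->. now apply Hab. }
      { intros j Hj. now apply GP1. }
      assert (ED : dot (vsub b a) (bisector n i) = H b - H a)
        by (unfold H; unfold_plane; ring).
      assert (ECr : Rabs (cross (vsub b a) (bisector n i)) = Rabs (X b - X a)).
      { rewrite <- Habs. f_equal. unfold X; unfold_plane; ring. }
      apply reach_weaken with (cone_cost n j (vsub b a)).
      + apply IH; auto.
        * now apply (can_see_unobstructed P S a b HV).
        * apply Rlt_le_trans with (H b); [|exact Hhb].
          apply (edge_proj_lt n i j _ (H a)); auto.
          rewrite ECr. apply Rabs_def2 in Ca, Cb. apply Rabs_le. lra.
      + rewrite <- ED, <- ECr, <- EC. apply Hcost; auto. lra. }
  apply (reach_weaken _ _ _ _ _ (reach_trans _ _ _ _ _ _ Hedge Hchain)).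
  (* The offset of [p] charged to the chain cancels against the one that [pdist_le_corner] subtracts
     for the edge [up]. *)
  rewrite EC. unfold X. rewrite !Habs. fold (H w). fold (H p) in Hlen. lra.
Qed.

Theorem theorem5 (k : nat) (P : list point) (S : list (point * point))
  (u w : point) (i : nat) :
  (1 <= k)%nat ->
  NoDup P ->
  valid_constraints P S ->
  general_position (4 * k + 5) P ->
  In u P -> In w P -> u <> w ->
  can_see S u w ->
  in_cone (4 * k + 5) i u w ->
  let theta := cone_angle (4 * k + 5) in
  let alpha := vangle (vsub w u) (vsub (canon_mid (4 * k + 5) i u w) u) in
  exists l : list point,
    is_path (theta_adj (4 * k + 5) P S) u l /\ last l u = w /\
    path_length u l <=
      (cos alpha / cos (theta / 2) +
       (cos alpha * tan (theta / 2) + sin alpha) * cos (theta / 4) /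
         (cos (theta / 2) - sin (3 * theta / 4))) * pdist u w.
Proof.
  intros Hk _ HV HG Hu Hw Huw Hsee Hc theta alpha.
  destruct (visible_pair_reach k P S Hk HV HG u w i Hu Hw Hsee Hc) as (l & H1 & H2 & H3).
  exists l. split; [exact H1|]. split; [exact H2|].
  apply (Rle_trans _ _ _ H3). apply Req_le.
  assert (Hn : (9 <= 4 * k + 5)%nat) by lia.
  pose proof (in_cone_dot_pos _ _ _ _ Hn Hc) as Hh.
  pose proof (norm_vsub_pos u w (not_eq_sym Huw)) as HN.
  (* The vector [um] is the unit bisector scaled by the positive height [h], so [alpha] is the angle
     between [uw] and the bisector. *)
  assert (Ea : alpha = acos (dot (vsub w u) (bisector (4 * k + 5) i) / norm (vsub w u))).
  { unfold alpha, vangle, canon_mid, proj.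
    set (b := bisector (4 * k + 5) i) in *. set (h := dot (vsub w u) b) in *.
    assert (E : vsub (fst u + h * fst b, snd u + h * snd b) u = (h * fst b, h * snd b)).
    { apply (vsub_add u (h * fst b, h * snd b)). }
    rewrite E.
    assert (ED : dot (vsub w u) (h * fst b, h * snd b) = h * h)
      by (unfold h at 3, dot; cbn [fst snd]; ring).
    assert (EN : norm (h * fst b, h * snd b) = h).
    { unfold norm, dot; cbn [fst snd].
      replace (h * fst b * (h * fst b) + h * snd b * (h * snd b))
        with (Rsqr h * (fst b ^ 2 + snd b ^ 2)) by (unfold Rsqr; ring).
      unfold b. rewrite bisector_unit, Rmult_1_r. apply sqrt_Rsqr. lra. }
    rewrite ED, EN. f_equal. field. lra. }
  destruct (cos_sin_acos_bisector (4 * k + 5) i _ HN) as [C1 S1]. rewrite <- Ea in C1, S1.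
  unfold cone_cost, pdist. rewrite <- C1, <- S1.
  unfold chain_factor, half_tan. fold theta. unfold Rdiv. ring.
Qed.
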